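(* Let $(\nu_j)_{j\in \mathbb N}$ be an equidistributed averaging sequence of probability measures on $\mathbb Z$, and let $A, B\subset \mathbb Z$ with $d^*(B)>0$. Then the following implications hold. (1) If $d_\nu(A)>0$, then $A+B$ is piecewise Bohr. (2) If $d_\nu(A)=1$, then $A+B$ is thick.
   Context: $A+B:=\{a+b:a\in A,b\in B\}$. The upper Banach density of $B\subset\mathbb Z$ is $d^*(B):=\lim_{M\to\infty}\sup_{N\in\mathbb Z}\frac{|B\cap[N,N+M-1]|}{M}$. A sequence $(\nu_j)_{j\in\mathbb N}$ of probability measures on $\mathbb Z$ is an equidistributed averaging sequence if for all $\theta\in(0,2\pi)$, $\lim_{j\to\infty}\int e^{in\theta}\,d\nu_j(n)=0$. For such a sequence and $A\subset\mathbb Z$, $d_\nu(A):=\limsup_{j\to\infty}\nu_j(A)$. A set $S\subset\mathbb Z$ is thick if for every $L\in\mathbb N$ it contains an interval of integers of length $L$. A set $S\subset\mathbb Z$ is Bohr if there is a trigonometric polynomial $P(n)=\sum_{j=1}^k c_je^{i\lambda_jn}$ ($c_j\in\mathbb C$, $\lambda_j\in\mathbb R$) such that $\{n\in\mathbb Z:\operatorname{Re}P(n)>0\}$ is nonempty and contained in $S$. A set is piecewise Bohr if it contains the intersection of a Bohr set and a thick set (equivalently, is such an intersection). *)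

(* Defs.v *)
From HB Require Import structures.
From mathcomp Require Import all_boot all_order all_algebra.
From mathcomp Require Import finmap.
From mathcomp Require Import all_classical all_reals all_analysis.
From mathcomp Require Import complex.

Set Implicit Arguments.
Unset Strict Implicit.
Unset Printing Implicit Defensive.

Import Order.TTheory GRing.Theory Num.Theory.
Import numFieldNormedType.Exports.

Local Open Scope classical_set_scope.
Local Open Scope ring_scope.

HB.instance Definition _ := isPointed.Build int 0.

(* Every subset of int is measurable, so that [probability int R] is the type
   of all probability measures on the integers. *)
HB.instance Definition _ := @isMeasurable.Build default_measure_display
  int discrete_measurable discrete_measurable0
  discrete_measurableC discrete_measurableU.

Definition sumset (A B : set int) : set int :=
  [set a + b | a in A & b in B].

Definition int_interval (N : int) (M : nat) : set int :=
  [set` `[N, N + M%:Z - 1]].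

(* At M = 0 the quotient is the junk value 0, which does not affect the limit;
   the suprema are over nonempty sets bounded by 1, and the limit exists by
   subadditivity in M. *)
Definition upper_banach_density (R : realType) (B : set int) : R :=
  limn (fun M : nat =>
    sup (range (fun N : int =>
      (#|` fset_set (B `&` int_interval N M)|)%:R / M%:R : R))).

Definition expi (R : realType) (t : R) : R[i] := Complex (cos t) (sin t).

Definition cintegral d (T : measurableType d) (R : realType)
    (mu : {measure set T -> \bar R}) (f : T -> R[i]) : R[i] :=
  Complex (\int[mu]_(x in setT) complex.Re (f x))%R
          (\int[mu]_(x in setT) complex.Im (f x))%R.

(* The regular algebra R[i]^o carries the topology of the complex modulus. *)
Definition equidistributed (R : realType) (nu : nat -> probability int R) :=
  forall theta : R, 0 < theta < 2 * pi ->
    (fun j => cintegral (nu j) (fun n => expi (n%:~R * theta)) : R[i]^o)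
      @ \oo --> (0 : R[i]^o).

Definition density_along (R : realType) (nu : nat -> probability int R)
    (A : set int) : \bar R :=
  limn_esup (fun j => nu j A).

Definition thick (S : set int) : Prop :=
  forall L : nat, exists N : int, int_interval N L `<=` S.

Definition trig_poly (R : realType) (k : nat) (c : 'I_k -> R[i])
    (lambda : 'I_k -> R) (n : int) : R[i] :=
  \sum_(j < k) c j * expi (lambda j * n%:~R).

Definition bohr (R : realType) (S : set int) : Prop :=
  exists (k : nat) (c : 'I_k -> R[i]) (lambda : 'I_k -> R),
    let U := [set n : int | 0 < complex.Re (trig_poly c lambda n)] in
    U !=set0 /\ U `<=` S.

Definition piecewise_bohr (R : realType) (E : set int) : Prop :=
  exists S T : set int, [/\ bohr R S, thick T & S `&` T `<=` E].

(* Main.v *)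
(* Let f be the indicator function of B restricted to a long interval on which B
   has density at least delta > 0, extended periodically, and let Lambda be an
   ultralimit of the spectral measures of these functions along longer and longer
   intervals: a positive functional on Lipschitz functions on the unit circle. It
   satisfies the bounded convergence theorem, by the argument of Daniell and Dini,
   so that no representation by a measure is needed.

   Let w_j be a finitely supported truncation of nu_j and u_j its restriction to
   A, so that x is in A + B as soon as (u_j * f)(x) > 0. The large sieve
   inequality and the convergence to 0 of the transform of w_j away from 1 show
   that, up to a small error in mean square, u_j * f is the sum of u_j^(k) F_k
   over the atoms k of Lambda, where F_k is the component of f at the frequency k,
   a local average of f twisted by k. As F_k is almost an eigenfunction of the
   shift, u_j * f is bounded from below on arbitrarily long windows by a
   trigonometric polynomial with a fixed finite set of frequencies, the mean of
   which is bounded from below in terms of delta and of the nu-density of A. A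
   limit of these polynomials defines the Bohr set. If A has nu-density 1, then
   u_j^(k) tends to 0 for every k other than 1 and the limit is a positive
   constant, hence the Bohr set is the set of all integers. *)

Require Import Defs.
From HB Require Import structures.
From mathcomp Require Import all_boot all_order all_algebra.
From mathcomp Require Import finmap.
From mathcomp Require Import all_classical all_reals all_analysis.
From mathcomp Require Import complex zify ring lra.

Set Implicit Arguments.
Unset Strict Implicit.
Unset Printing Implicit Defensive.

Import Order.TTheory GRing.Theory Num.Theory.
Import numFieldNormedType.Exports.

Local Open Scope complex_scope.
Local Open Scope classical_set_scope.
Local Open Scope ring_scope.

(** * Complex numbers and the unit circle *)

(** The hypothesis on [nu] is pointwise: it gives no rate, and no uniformity near 1. Dominating by
    dyadic kernels, Lipschitz functions that decrease to the indicator of a point, lets bounded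
    convergence stand in for uniform estimates. The non-atomic part of the spectrum is harmless
    because the large sieve bounds the error by a double integral of |w_j^(s/t)|; in the limit only
    the diagonal s = t counts, and its weight is governed by the largest atom left out.

    The order of choices matters. The limit functional comes before everything, so j can be fixed
    from it alone. Only then is the interval carrying f taken long compared with the support of w_j,
    and close to the limit on the two test functions that involve j. Evaluating away from the ends
    of the interval avoids wrap-around, so a positive value of the convolution really produces a
    point of A and a point of B. The frequency 1 keeps the polynomial from degenerating: its
    coefficient is the mass of u_j times a local density of f. *)

Section ComplexModulus.
Context {R : realType}.
Implicit Types z : R[i].

Definition sqmod z : R := complex.Re z ^+ 2 + complex.Im z ^+ 2.

Definition cmod z : R := Num.sqrt (sqmod z).

Lemma sqmod_ge0 z : 0 <= sqmod z.
Proof. by rewrite addr_ge0 ?sqr_ge0. Qed.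

Lemma cmod_ge0 z : 0 <= cmod z.
Proof. exact: sqrtr_ge0. Qed.

Lemma sqr_cmod z : cmod z ^+ 2 = sqmod z.
Proof. by rewrite sqr_sqrtr ?sqmod_ge0. Qed.

Lemma norm_cmod z : `|z| = (cmod z)%:C.
Proof. exact: normc_def. Qed.

Lemma sqmod_norm z : (sqmod z)%:C = `|z| ^+ 2.
Proof. exact: add_Re2_Im2. Qed.

Lemma cmodM z1 z2 : cmod (z1 * z2) = cmod z1 * cmod z2.
Proof. by have := normrM z1 z2; rewrite !norm_cmod -rmorphM => /complexI. Qed.

Lemma sqmodM z1 z2 : sqmod (z1 * z2) = sqmod z1 * sqmod z2.
Proof. by rewrite -!sqr_cmod cmodM exprMn. Qed.

Lemma cmodD z1 z2 : cmod (z1 + z2) <= cmod z1 + cmod z2.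
Proof. by have := ler_normD z1 z2; rewrite !norm_cmod -rmorphD lecR. Qed.

Lemma cmodN z : cmod (- z) = cmod z.
Proof. by apply: complexI; rewrite -!norm_cmod normrN. Qed.

Lemma cmodB z1 z2 : cmod (z1 - z2) = cmod (z2 - z1).
Proof. by rewrite -cmodN opprB. Qed.

Lemma cmod0 : cmod 0 = 0.
Proof. by apply: complexI; rewrite -norm_cmod normr0. Qed.

Lemma cmod1 : cmod 1 = 1.
Proof. by apply: complexI; rewrite -norm_cmod normr1. Qed.

Lemma cmodV z : cmod z^-1 = (cmod z)^-1.
Proof. by have := normfV z; rewrite !norm_cmod -fmorphV => /complexI. Qed.

Lemma cmodX z n : cmod (z ^+ n) = cmod z ^+ n.
Proof. by have := normrX n z; rewrite !norm_cmod -rmorphXn => /complexI. Qed.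

Lemma cmod_real (x : R) : cmod x%:C = `|x|.
Proof. by rewrite /cmod /sqmod /= expr0n addr0 sqrtr_sqr. Qed.

Lemma cmod_conj z : cmod z^*%C = cmod z.
Proof. by apply: complexI; rewrite -!norm_cmod normcJ. Qed.

Lemma cmod_sum I (r : seq I) (P : pred I) (F : I -> R[i]) :
  cmod (\sum_(i <- r | P i) F i) <= \sum_(i <- r | P i) cmod (F i).
Proof.
elim/big_rec2: _ => [|i x y _ le_yx]; first by rewrite cmod0.
exact: (le_trans (cmodD _ _) (lerD _ _)).
Qed.

Lemma cmod_eq0 z : (cmod z == 0) = (z == 0).
Proof. by rewrite -(inj_eq (@complexI R)) -norm_cmod normr_eq0. Qed.

Lemma sqmod_eq0 z : (sqmod z == 0) = (z == 0).
Proof. by rewrite -sqr_cmod sqrf_eq0 cmod_eq0. Qed.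

Lemma Re_le_cmod z : `|complex.Re z| <= cmod z.
Proof. by rewrite -lecR -norm_cmod normc_ge_Re. Qed.

Lemma Re_leN z : - cmod z <= complex.Re z.
Proof. by have := Re_le_cmod z; rewrite ler_norml => /andP[]. Qed.

Lemma Re_le z : complex.Re z <= cmod z.
Proof. by have := Re_le_cmod z; rewrite ler_norml => /andP[]. Qed.

Lemma cmod_le_sum z : cmod z <= `|complex.Re z| + `|complex.Im z|.
Proof.
have h : 0 <= `|complex.Re z| + `|complex.Im z| by rewrite addr_ge0.
rewrite -[leRHS]ger0_norm// -sqrtr_sqr ler_wsqrtr// /sqmod.
rewrite sqrrD !real_normK ?num_real//.
by rewrite lerD2r lerDl mulrn_wge0// mulr_ge0.
Qed.

Lemma ReM z1 z2 : complex.Re (z1 * z2) =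
  complex.Re z1 * complex.Re z2 - complex.Im z1 * complex.Im z2.
Proof. by case: z1 => a b; case: z2. Qed.

Lemma ImM z1 z2 : complex.Im (z1 * z2) =
  complex.Re z1 * complex.Im z2 + complex.Im z1 * complex.Re z2.
Proof. by case: z1 => a b; case: z2. Qed.

Lemma ReD z1 z2 : complex.Re (z1 + z2) = complex.Re z1 + complex.Re z2.
Proof. by case: z1 => a b; case: z2. Qed.

Lemma ImD z1 z2 : complex.Im (z1 + z2) = complex.Im z1 + complex.Im z2.
Proof. by case: z1 => a b; case: z2. Qed.

Lemma ReN z : complex.Re (- z) = - complex.Re z.
Proof. by case: z. Qed.

Lemma ImN z : complex.Im (- z) = - complex.Im z.
Proof. by case: z. Qed.

Lemma Re_sum I (r : seq I) (P : pred I) (F : I -> R[i]) :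
  complex.Re (\sum_(i <- r | P i) F i) = \sum_(i <- r | P i) complex.Re (F i).
Proof. exact: (big_morph _ ReD erefl). Qed.

Lemma Im_sum I (r : seq I) (P : pred I) (F : I -> R[i]) :
  complex.Im (\sum_(i <- r | P i) F i) = \sum_(i <- r | P i) complex.Im (F i).
Proof. exact: (big_morph _ ImD erefl). Qed.

Lemma ReZ (a : R) z : complex.Re (a%:C * z) = a * complex.Re z.
Proof. by rewrite ReM /= mul0r subr0. Qed.

Lemma ImZ (a : R) z : complex.Im (a%:C * z) = a * complex.Im z.
Proof. by rewrite ImM /= mul0r addr0. Qed.

Lemma mulcJ z : z * z^*%C = (sqmod z)%:C.
Proof. by rewrite sqmod_norm sqr_normc. Qed.

End ComplexModulus.

Record circle (R : realType) :=
  Circle { cval :> R[i]; _ : cmod cval == 1 }.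
Arguments Circle {R} _ _.

HB.instance Definition _ (R : realType) := [isSub for @cval R].
HB.instance Definition _ (R : realType) := [Choice of circle R by <:].

Section Circle.
Context {R : realType}.
Local Notation T := (circle R).
Implicit Types s t z : T.

Lemma circle_cmod z : cmod z = 1.
Proof. by case: z => z /= /eqP. Qed.

Lemma circle_sqmod z : sqmod z = 1.
Proof. by rewrite -sqr_cmod circle_cmod expr1n. Qed.

Lemma circle_neq0 z : cval z != 0.
Proof. by rewrite -cmod_eq0 circle_cmod oner_eq0. Qed.

Lemma circle_exprz z (n : int) : cmod (cval z ^ n) = 1.
Proof.
case: n => n; first by rewrite -exprnP cmodX circle_cmod expr1n.
by rewrite NegzE -exprnN cmodV cmodX circle_cmod expr1n invr1.
Qed.

Lemma circle_conj z : (cval z)^*%C = (cval z)^-1.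
Proof.
apply: (mulfI (circle_neq0 z)).
by rewrite mulcJ circle_sqmod mulfV ?circle_neq0.
Qed.

Fact circle1_subproof : cmod (1 : R[i]) == 1.
Proof. by rewrite cmod1. Qed.
Definition circle1 : T := Circle 1 circle1_subproof.

Fact circle_div_subproof s t : cmod (cval s / cval t) == 1.
Proof. by rewrite cmodM cmodV !circle_cmod mulfV ?oner_eq0. Qed.
Definition circle_div s t : T := Circle (cval s / cval t) (circle_div_subproof s t).

End Circle.

(** * Ultralimits and Lipschitz functions *)

Section UltraLimit.

Fact nat_ultra_subproof :
  {G : set_system nat | UltraFilter G /\ \oo `<=` G}.
Proof. exact/cid/ultraFilterLemma. Qed.

Definition nat_ultra : set_system nat := sval nat_ultra_subproof.

Global Instance nat_ultraP : UltraFilter nat_ultra.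
Proof. by rewrite /nat_ultra; case: nat_ultra_subproof => G []. Qed.

Lemma eventually_nat_ultra : \oo `<=` nat_ultra.
Proof. by rewrite /nat_ultra; case: nat_ultra_subproof => G []. Qed.

Lemma nat_ultra_ge N : \forall n \near nat_ultra, (N <= n)%N.
Proof. by apply: eventually_nat_ultra; exists N. Qed.

Context {R : realType}.
Implicit Types u v : nat -> R.

Definition ulim u : R := lim (u @ nat_ultra).

(** The image of an ultrafilter under [u] is an ultrafilter containing the compact interval [-C, C],
    so it converges. *)
Lemma ulim_cvg u C : (forall n, `|u n| <= C) -> u @ nat_ultra --> ulim u.
Proof.
move=> bu.
have UF : UltraFilter (u @ nat_ultra).
  apply: Build_UltraFilter => H PH sub; apply/seteqP; split=> // A HA.
  have [//|/(sub (~` A)) HnA] := in_ultra_setVsetC (u @^-1` A) nat_ultraP.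
  by have /filter_ex[x []] : H (A `&` ~` A) by exact: filterI.
have := @segment_compact R (- C) C; rewrite compact_ultra => /(_ _ UF).
case.
  rewrite /fmap /=; apply: (@filterE nat nat_ultra) => n /=.
  by rewrite in_itv /= -ler_norml.
move=> l [_ ul]; apply/cvg_ex; exists l; exact: ul.
Qed.

Lemma cvg_ulim u l : u @ nat_ultra --> l -> ulim u = l.
Proof. by move=> /cvg_lim; apply. Qed.

Lemma ulim_cst l : ulim (fun=> l) = l.
Proof. apply: cvg_ulim; exact: cvg_cst. Qed.

Lemma ulimD u v C D : (forall n, `|u n| <= C) -> (forall n, `|v n| <= D) ->
  ulim (fun n => u n + v n) = ulim u + ulim v.
Proof.
move=> /ulim_cvg ucv /ulim_cvg vcv; apply: cvg_ulim; exact: cvgD.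
Qed.

Lemma ulimZ u c C : (forall n, `|u n| <= C) ->
  ulim (fun n => c * u n) = c * ulim u.
Proof. by move=> /ulim_cvg ucv; apply: cvg_ulim; exact: cvgMr. Qed.

Lemma ulim_ge0 u C : (forall n, 0 <= u n <= C) -> 0 <= ulim u.
Proof.
move=> bu; have ucv : u @ nat_ultra --> ulim u.
  by apply: (@ulim_cvg _ C) => n; have /andP[? ?] := bu n; rewrite ger0_norm.
apply: (cvgr_to_ge ucv).
by near=> n; have /andP[] := bu n.
Unshelve. all: by end_near. Qed.

Lemma near_ulim u C e : (forall n, `|u n| <= C) -> 0 < e ->
  \forall n \near nat_ultra, `|u n - ulim u| < e.
Proof.
move=> bu e0; have /cvgrPdist_lt/(_ e e0) := ulim_cvg bu.
by apply: filterS => n; rewrite distrC.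
Qed.

End UltraLimit.

Section Lipschitz.
Context {R : realType} {X : Type} (d : X -> X -> R).
Implicit Types u v : X -> R.

(** Boundedness is included so that the class is closed under products. *)
Definition lip u :=
  (exists2 C, 0 <= C & forall x y, `|u x - u y| <= C * d x y) /\
  (exists2 C, 0 <= C & forall x, `|u x| <= C).

Lemma lip_cst a : lip (fun=> a).
Proof.
split; last by exists `|a|.
by exists 0 => // x y; rewrite subrr normr0 mul0r.
Qed.

Lemma lipD u v : lip u -> lip v -> lip (fun x => u x + v x).
Proof.
move=> [[C C0 uC] [B B0 uB]] [[D D0 vD] [E E0 vE]]; split.
  exists (C + D); first exact: addr_ge0.
  move=> x y; rewrite mulrDl opprD addrACA.
  by rewrite (le_trans (ler_normD _ _))// lerD.
exists (B + E); first exact: addr_ge0.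
by move=> x; rewrite (le_trans (ler_normD _ _))// lerD.
Qed.

Lemma lipM u v : lip u -> lip v -> lip (fun x => u x * v x).
Proof.
move=> [[C C0 uC] [B B0 uB]] [[D D0 vD] [E E0 vE]]; split.
  exists (B * D + E * C); first by rewrite addr_ge0// mulr_ge0.
  move=> x y; have -> : u x * v x - u y * v y =
    u x * (v x - v y) + v y * (u x - u y) by ring.
  rewrite (le_trans (ler_normD _ _))// !normrM mulrDl -!mulrA.
  by rewrite lerD// ler_pM.
exists (B * E); first exact: mulr_ge0.
by move=> x; rewrite normrM ler_pM.
Qed.

Lemma lipZ a u : lip u -> lip (fun x => a * u x).
Proof. by move=> ul; apply: lipM => //; exact: lip_cst. Qed.

Lemma lipN u : lip u -> lip (fun x => - u x).
Proof.
by move=> /(lipZ (-1)); congr lip; apply/funext => x; rewrite mulN1r.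
Qed.

Lemma lipB u v : lip u -> lip v -> lip (fun x => u x - v x).
Proof. by move=> ul vl; apply: lipD => //; exact: lipN. Qed.

Lemma lip_sum I (r : seq I) (P : pred I) (F : I -> X -> R) :
  (forall i, lip (F i)) -> lip (fun x => \sum_(i <- r | P i) F i x).
Proof.
move=> Fl; elim: r => [|i r ih].
  by rewrite (_ : (fun x => _) = fun=> 0); [exact: lip_cst|
     apply/funext => x; rewrite big_nil].
have [Pi|/negbTE Pi] := boolP (P i).
  rewrite (_ : (fun x => _) =
    fun x => F i x + \sum_(i <- r | P i) F i x); first exact: lipD.
  by apply/funext => x; rewrite big_cons Pi.
rewrite (_ : (fun x => _) = fun x => \sum_(i <- r | P i) F i x)//.
by apply/funext => x; rewrite big_cons Pi.
Qed.

Lemma lip_norm u : lip u -> lip (fun x => `|u x|).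
Proof.
move=> [[C C0 uC] [B B0 uB]]; split.
  by exists C => // x y; exact: le_trans (ler_dist_dist _ _) (uC x y).
by exists B => // x; rewrite normr_id.
Qed.

Lemma lip_max u v : lip u -> lip v -> lip (fun x => Num.max (u x) (v x)).
Proof.
move=> ul vl.
rewrite (_ : (fun x => _) = fun x => 2^-1 * (u x + v x + `|u x - v x|)).
  by apply: lipZ; apply: lipD; [exact: lipD|exact/lip_norm/lipB].
by apply/funext => x; rewrite maxr_absE mulrC.
Qed.

Lemma lip_min u v : lip u -> lip v -> lip (fun x => Num.min (u x) (v x)).
Proof.
move=> ul vl.
rewrite (_ : (fun x => _) = fun x => 2^-1 * (u x + v x - `|u x - v x|)).
  by apply: lipZ; apply: lipB; [exact: lipD|exact/lip_norm/lipB].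
by apply/funext => x; rewrite minr_absE mulrC.
Qed.

(** Stated through real and imaginary parts because the functionals below act on real functions. *)
Definition clip (f : X -> R[i]) :=
  lip (fun x => complex.Re (f x)) /\ lip (fun x => complex.Im (f x)).

Lemma clip_cst a : clip (fun=> a).
Proof. by split; exact: lip_cst. Qed.

Lemma clipD f g : clip f -> clip g -> clip (fun x => f x + g x).
Proof.
move=> [fr fi] [gr gi]; split.
  by under eq_fun do rewrite ReD; exact: lipD.
by under eq_fun do rewrite ImD; exact: lipD.
Qed.

Lemma clipM f g : clip f -> clip g -> clip (fun x => f x * g x).
Proof.
move=> [fr fi] [gr gi]; split.
  by under eq_fun do rewrite ReM; apply: lipB; exact: lipM.
by under eq_fun do rewrite ImM; apply: lipD; exact: lipM.
Qed.

Lemma clipZ a f : clip f -> clip (fun x => a * f x).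
Proof. by move=> fl; apply: clipM => //; exact: clip_cst. Qed.

Lemma clipB f g : clip f -> clip g -> clip (fun x => f x - g x).
Proof.
move=> fl gl; apply: clipD => //.
by have := clipZ (-1) gl; congr clip; apply/funext => x; rewrite mulN1r.
Qed.

Lemma clip_conj f : clip f -> clip (fun x => (f x)^*%C).
Proof.
move=> [fr fi]; split.
  by move: fr; congr lip; apply/funext => x; case: (f x).
by move: (lipN fi); congr lip; apply/funext => x; case: (f x).
Qed.

Lemma clip_sum I (r : seq I) (P : pred I) (F : I -> X -> R[i]) :
  (forall i, clip (F i)) -> clip (fun x => \sum_(i <- r | P i) F i x).
Proof.
move=> Fl; split.
  by under eq_fun do rewrite Re_sum; apply: lip_sum => i; case: (Fl i).
by under eq_fun do rewrite Im_sum; apply: lip_sum => i; case: (Fl i).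
Qed.

Lemma clipX f n : clip f -> clip (fun x => f x ^+ n).
Proof.
move=> fl; elim: n => [|n ih]; first exact: clip_cst.
by under eq_fun do rewrite exprS; exact: clipM.
Qed.

Lemma lip_sqmod f : clip f -> lip (fun x => sqmod (f x)).
Proof. by move=> [fr fi]; apply: lipD; exact: lipM. Qed.

Lemma lip_cmod f : clip f -> lip (fun x => cmod (f x)).
Proof.
move=> [[[C C0 rC] [B B0 rB]] [[D D0 iD] [E E0 iE]]]; split.
  exists (C + D); first exact: addr_ge0.
  move=> x y; apply: (@le_trans _ _ (cmod (f x - f y))).
    rewrite ler_norml; apply/andP; split.
      have := cmodD (f y - f x) (f x); rewrite subrK cmodB; lra.
    have := cmodD (f x - f y) (f y); rewrite subrK; lra.
  rewrite (le_trans (cmod_le_sum _))// mulrDl.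
  by rewrite ReD ReN ImD ImN lerD.
exists (B + E); first exact: addr_ge0.
move=> x; rewrite ger0_norm ?cmod_ge0//.
by rewrite (le_trans (cmod_le_sum _))// lerD.
Qed.

End Lipschitz.

Lemma lip_comp {R : realType} {X Y : Type} (dX : X -> X -> R)
    (dY : Y -> Y -> R) (phi : X -> Y) (C : R) (u : Y -> R) : 0 <= C ->
  (forall x y, dY (phi x) (phi y) <= C * dX x y) ->
  lip dY u -> lip dX (fun x => u (phi x)).
Proof.
move=> C0 phiC [[D D0 uD] [B B0 uB]]; split; last by exists B.
exists (D * C); first exact: mulr_ge0.
by move=> x y; rewrite (le_trans (uD _ _))// -mulrA ler_wpM2l.
Qed.

Section CircleMetric.
Context {R : realType}.
Local Notation T := (circle R).
Implicit Types s t z : T.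

(** The l^1 distance of the coordinates: equivalent to the chordal distance, free of square roots,
    and making real and imaginary parts 1-Lipschitz at once. *)
Definition cdist s t : R :=
  `|complex.Re (cval s) - complex.Re (cval t)| +
  `|complex.Im (cval s) - complex.Im (cval t)|.

Definition cdist2 (p q : T * T) : R := cdist p.1 q.1 + cdist p.2 q.2.

Lemma cdist_ge0 s t : 0 <= cdist s t.
Proof. exact: addr_ge0. Qed.

Lemma cdistxx s : cdist s s = 0.
Proof. by rewrite /cdist !subrr !normr0 addr0. Qed.

Lemma circle_Re_le z : `|complex.Re (cval z)| <= 1.
Proof. by rewrite -(circle_cmod z) Re_le_cmod. Qed.

Lemma circle_Im_le z : `|complex.Im (cval z)| <= 1.
Proof.
have h : 0 <= complex.Re (cval z) ^+ 2 := sqr_ge0 _.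
rewrite -ler_sqr ?nnegrE// expr1n real_normK ?num_real//.
by rewrite -(circle_sqmod z) /sqmod lerDr.
Qed.

Lemma clip_val : clip cdist (fun z : T => cval z).
Proof.
split; split.
- by exists 1 => // x y; rewrite mul1r lerDl.
- by exists 1 => // x; exact: circle_Re_le.
- by exists 1 => // x y; rewrite mul1r lerDr.
- by exists 1 => // x; exact: circle_Im_le.
Qed.

Lemma clip_exprz (n : int) : clip cdist (fun z : T => cval z ^ n).
Proof.
case: n => n; first exact/clipX/clip_val.
have := clipX n.+1 (clip_conj clip_val); congr clip; apply/funext => z.
by rewrite NegzE -exprnN circle_conj exprVn.
Qed.

Lemma lip_fst (u : T -> R) : lip cdist u -> lip cdist2 (fun p => u p.1).
Proof.
apply: (lip_comp (C := 1)) => // x y.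
by rewrite mul1r lerDl cdist_ge0.
Qed.

Lemma lip_snd (u : T -> R) : lip cdist u -> lip cdist2 (fun p => u p.2).
Proof.
apply: (lip_comp (C := 1)) => // x y.
by rewrite mul1r lerDr cdist_ge0.
Qed.

Lemma clip_fst (u : T -> R[i]) : clip cdist u -> clip cdist2 (fun p => u p.1).
Proof. by move=> [ur ui]; split; [exact: (lip_fst ur)|exact: (lip_fst ui)]. Qed.

Lemma clip_snd (u : T -> R[i]) : clip cdist u -> clip cdist2 (fun p => u p.2).
Proof. by move=> [ur ui]; split; [exact: (lip_snd ur)|exact: (lip_snd ui)]. Qed.

Lemma lip_section u s : lip cdist2 u -> lip cdist (fun t => u (s, t)).
Proof.
apply: (lip_comp (C := 1)) => // x y.
by rewrite mul1r /cdist2 /= cdistxx add0r.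
Qed.

(** On the circle, division is multiplication by the conjugate. Each coordinate of s / t is a sum of
    two products of numbers of modulus at most 1, so each of the two coordinates contributes the
    distance once: the constant is 2. *)
Lemma lip_div (u : T -> R) :
  lip cdist u -> lip cdist2 (fun p => u (circle_div p.1 p.2)).
Proof.
have bnd (a b a' b' : R) : `|b| <= 1 -> `|a'| <= 1 ->
    `|a * b - a' * b'| <= `|a - a'| + `|b - b'|.
  move=> b1 a1; have -> : a * b - a' * b' = (a - a') * b + a' * (b - b').
    by ring.
  rewrite (le_trans (ler_normD _ _))// !normrM.
  by rewrite lerD// ?ler_piMr// ler_piMl.
apply: (lip_comp (C := 2)) => // -[s t] [s' t']; rewrite /cdist2 /cdist /=.
rewrite -!circle_conj !ReM !ImM.
move: (circle_Re_le s') (circle_Im_le s') (circle_Re_le t) (circle_Im_le t).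
case: (cval s) (cval t) (cval s') (cval t') => [a b] [c e] [a' b'] [c' e'] /=.
move=> ha hb hc he.
have := bnd a c a' c' hc ha; have := bnd b e b' e' he hb.
have := bnd a e a' e' he ha; have := bnd b c b' c' hc hb.
have tri (x y z : R) : `|x| <= y -> `|x + z| <= y + `|z|.
  by move=> h; rewrite (le_trans (ler_normD _ _))// lerD2r.
have e1 : a * c - b * - e - (a' * c' - b' * - e') =
  a * c - a' * c' + (b * e - b' * e') by ring.
have e2 : a * - e + b * c - (a' * - e' + b' * c') =
  - (a * e - a' * e') + (b * c - b' * c') by ring.
rewrite e1 e2 => h1 h2 h3 h4.
have := ler_normD (a * c - a' * c') (b * e - b' * e').
have := ler_normD (- (a * e - a' * e')) (b * c - b' * c').
rewrite normrN; lra.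
Qed.

(** Sequential compactness without subsequences: the ultralimits of the coordinates again satisfy
    a^2 + b^2 = 1, and the ultrafilter contains indices beyond any [N] that are close to them. *)
Lemma circle_cluster (z : nat -> T) : exists l : T,
  forall e, 0 < e -> forall N, exists2 n, (N <= n)%N & cdist (z n) l < e.
Proof.
pose a n := complex.Re (cval (z n)); pose b n := complex.Im (cval (z n)).
have ba n : `|a n| <= 1 := circle_Re_le _.
have bb n : `|b n| <= 1 := circle_Im_le _.
have la := ulim_cvg ba; have lb := ulim_cvg bb.
have l1 : cmod (Complex (ulim a) (ulim b)) == 1.
  rewrite /cmod /sqmod /=.
  suff -> : ulim a ^+ 2 + ulim b ^+ 2 = 1 by rewrite sqrtr1.
  rewrite -(ulim_cst 1); apply/esym/cvg_ulim.
  rewrite (_ : (fun=> 1) = (fun n => a n * a n + b n * b n)); last first.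
    by apply/funext => n; rewrite -!expr2 -(circle_sqmod (z n)).
  by apply: cvgD; exact: cvgM.
exists (Circle _ l1) => e e0 N.
have e2 : 0 < e / 2 by rewrite divr_gt0.
have [n [Nn [na nb]]] := @filter_ex _ nat_ultra _ _ (filterI (nat_ultra_ge N)
  (filterI (near_ulim ba e2) (near_ulim bb e2))).
exists n => //.
by rewrite /cdist /= [X in _ < X](splitr e) ltrD.
Qed.

End CircleMetric.

(** * Bounded convergence for positive functionals *)

Section PositiveFunctional.
Context {R : realType}.
Local Notation T := (circle R).
Local Notation lipc := (@lip R T cdist).

(** Stands for a finite measure on the circle, known only through integrals of Lipschitz functions;
    [L (fun=> 1)] is its total mass. *)
Record positive_functional (L : (T -> R) -> R) : Prop := {
  pfunD : forall u v, lipc u -> lipc v ->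
    L (fun z => u z + v z) = L u + L v;
  pfunZ : forall c u, lipc u -> L (fun z => c * u z) = c * L u;
  pfun_ge0 : forall u, lipc u -> (forall z, 0 <= u z) -> 0 <= L u }.

Variable L : (T -> R) -> R.
Hypothesis HL : positive_functional L.
Implicit Types u v : T -> R.

Lemma pfun0 : L (fun=> 0) = 0.
Proof.
have := pfunZ HL 0 (lip_cst cdist 0).
by rewrite !mul0r.
Qed.

Lemma pfunB u v : lipc u -> lipc v -> L (fun z => u z - v z) = L u - L v.
Proof.
move=> ul vl; have vN : lipc (fun z => -1 * v z) by exact: lipZ.
have := pfunD HL ul vN; rewrite (pfunZ HL)// mulN1r => <-.
by congr L; apply/funext => z; rewrite mulN1r.
Qed.

Lemma pfun_le u v : lipc u -> lipc v -> (forall z, u z <= v z) -> L u <= L v.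
Proof.
move=> ul vl uv; rewrite -subr_ge0 -pfunB//.
by apply: (pfun_ge0 HL) => [|z]; [exact: lipB|rewrite subr_ge0].
Qed.

Lemma pfun_cst c : L (fun=> c) = c * L (fun=> 1).
Proof.
rewrite -(pfunZ HL); last exact: lip_cst.
by congr L; apply/funext => z; rewrite mulr1.
Qed.

Lemma pfun1_ge0 : 0 <= L (fun=> 1).
Proof. by apply: (pfun_ge0 HL) => //; exact: lip_cst. Qed.

Lemma pfun_le_cst u c : lipc u -> (forall z, u z <= c) ->
  L u <= c * L (fun=> 1).
Proof.
by move=> ul uc; rewrite -pfun_cst; apply: pfun_le => //; exact: lip_cst.
Qed.

Lemma pfun_sum I (r : seq I) (P : pred I) (F : I -> T -> R) :
  (forall i, lipc (F i)) ->
  L (fun z => \sum_(i <- r | P i) F i z) = \sum_(i <- r | P i) L (F i).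
Proof.
move=> Fl; elim: r => [|i r ih].
  by rewrite big_nil -[RHS]pfun0; congr L; apply/funext => z; rewrite big_nil.
rewrite big_cons; case: ifPn => Pi; rewrite -ih.
  rewrite -(pfunD HL)//; last exact: lip_sum.
  by congr L; apply/funext => z; rewrite big_cons Pi.
by congr L; apply/funext => z; rewrite big_cons (negbTE Pi).
Qed.

Lemma pfun_norm_le u c : lipc u -> (forall z, `|u z| <= c) ->
  `|L u| <= c * L (fun=> 1).
Proof.
move=> ul uc; rewrite ler_norml; apply/andP; split.
  rewrite -mulNr -pfun_cst; apply: pfun_le => //; first exact: lip_cst.
  by move=> z; have := uc z; rewrite ler_norml => /andP[].
apply: pfun_le_cst => // z.
by have := uc z; rewrite ler_norml => /andP[].
Qed.

(** Partial integration stays within Lipschitz functions, so [L] can be applied a second time. *)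
Lemma lip_pfun (u : T * T -> R) : lip cdist2 u ->
  lipc (fun s => L (fun t => u (s, t))).
Proof.
move=> ul; have ulc s := lip_section s ul.
have [[C C0 uC] [B B0 uB]] := ul; split; last first.
  exists (B * L (fun=> 1)); first by rewrite mulr_ge0// pfun1_ge0.
  by move=> s; apply: pfun_norm_le.
exists (C * L (fun=> 1)); first by rewrite mulr_ge0// pfun1_ge0.
move=> s s'; rewrite -pfunB// mulrAC; apply: pfun_norm_le; first exact: lipB.
move=> t; rewrite (le_trans (uC _ _))//.
by rewrite /cdist2 /= cdistxx addr0.
Qed.

(** Dini's argument: points [z n] with G n (z n) >= e cluster at some [l]. A fixed [G m] is small at
    [l], hence near [l] by the Lipschitz bound, yet monotonicity forces G m (z n) >= e for n >=
    m. *)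
Lemma uniform_of_decreasing (G : nat -> T -> R) :
  (forall n, lipc (G n)) ->
  (forall m n z, (m <= n)%N -> G n z <= G m z) ->
  (forall z e, 0 < e -> exists n, G n z < e) ->
  forall e, 0 < e -> exists n, forall z, G n z < e.
Proof.
move=> Gl Gdec G0 e e0; apply: contrapT => /forallNP nG.
have /choice[z zP] n : exists z, e <= G n z.
  by have /existsNP[z /negP] := nG n; rewrite -leNgt => h; exists z.
have [l lP] := circle_cluster z.
have e2 : 0 < e / 2 by rewrite divr_gt0.
have [m mP] := G0 l _ e2.
have [[C C0 GC] _] := Gl m.
have d0 : 0 < e / 2 / (C + 1) by rewrite !divr_gt0// ltr_wpDl.
have [n mn zn] := lP _ d0 m.
have h1 := le_trans (zP n) (Gdec _ _ (z n) mn).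
have h2 := le_trans (ler_norm _) (GC (z n) l).
have h3 : C * cdist (z n) l <= e / 2.
  apply: (@le_trans _ _ ((C + 1) * (e / 2 / (C + 1)))).
    by apply: ler_pM; rewrite ?cdist_ge0 ?lerDl ?(ltW zn).
  by rewrite mulrC divfK// gt_eqF// ltr_wpDl.
by have := splitr e; lra.
Qed.

(* The Daniell argument: the minima of the running maxima [M l (K l)] lose
   little mass when the cut-offs [K l] are large, and decrease uniformly to 0
   by Dini's theorem. *)
Lemma bounded_convergence (u : nat -> T -> R) C :
  (forall n, lipc (u n)) -> (forall n z, 0 <= u n z <= C) ->
  (forall z, u n z @[n --> \oo] --> (0 : R)) ->
  L (u n) @[n --> \oo] --> (0 : R).
Proof.
move=> ul ub u0.
have maxl (a b : R) : a <= Num.max a b by rewrite le_max lexx.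
have maxr (a b : R) : b <= Num.max a b by rewrite le_max lexx orbT.
have u_ge0 n z : 0 <= u n z by case/andP: (ub n z).
have u_le n z : u n z <= C by case/andP: (ub n z).
(* [M l k] is the maximum of [u n] over l <= n < l + k, with the convention [M l 0 = u l]. *)
pose M := fix M (l k : nat) (z : T) {struct k} : R :=
  if k is k'.+1 then Num.max (M l k' z) (u (l + k')%N z)
  else u l z.
have Ml l k : lipc (M l k).
  by elim: k => [|k ih] //=; exact: lip_max.
have M_mono l k k' z : (k <= k')%N -> M l k z <= M l k' z.
  move=> /subnK <-; elim: (k' - k)%N => [|j ih]//=.
  by rewrite le_max ih.
have M_le l k z c : (forall n, (l <= n)%N -> u n z <= c) -> M l k z <= c.
  move=> h; elim: k => [|k ih] /=; first exact: h.
  by rewrite ge_max ih h// leq_addr.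
have M_ge l k n z : (l <= n)%N -> (n < l + k)%N -> u n z <= M l k z.
  move=> ln nlk; apply: (@le_trans _ _ (M l (n - l).+1 z)).
    by rewrite /= le_max subnKC// lexx orbT.
  by apply: M_mono; rewrite ltn_subLR.
have M_tail l N k z : (l <= N)%N -> M N k z <= M l (N - l + k).+1 z.
  move=> lN; elim: k => [|k ih].
    by rewrite addn0; apply: M_ge => //; rewrite addnS subnKC.
  rewrite [leLHS]/= ge_max; apply/andP; split.
    by apply: (le_trans ih); apply: M_mono; rewrite addnS.
  by apply: M_ge; [rewrite (leq_trans lN)// leq_addr|
    rewrite addnS ltnS addnA subnKC// leq_add2l].
have LM l k : 0 <= L (M l k) <= C * L (fun=> 1).
  apply/andP; split.
    apply: (pfun_ge0 HL) => // z; apply: (le_trans (u_ge0 l z)).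
    by rewrite (@M_mono l 0 k).
  by apply: pfun_le_cst => // z; apply: M_le.
have LMcut l e : 0 < e -> exists K, forall k, L (M l k) <= L (M l K) + e.
  move=> e0; pose A := range (fun k => L (M l k)).
  have supA : has_sup A.
    split; first by exists (L (M l 0)), 0%N.
    by exists (C * L (fun=> 1)) => _ [k _ <-]; case/andP: (LM l k).
  have [_ [K _ <-] KP] := sup_adherent e0 supA.
  exists K => k; have : L (M l k) <= sup A.
    by apply: ub_le_sup; [case: supA|exists k].
  by move: KP; lra.
apply/cvgrPdist_le => e e0.
have e2 : 0 < e / 2 by rewrite divr_gt0.
(* The losses allowed at the successive cut-offs add up to less than e / 2. *)
have pe l : 0 < e / 2 / 2 ^+ l.+1 by rewrite divr_gt0// exprn_gt0.
have /choice[K KP] l := LMcut l _ (pe l).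
(* The minimum of the cut-off maxima up to [n]. It decreases, and tends to 0 pointwise because [G n]
   is at most the supremum of the [u m] with m >= n. *)
pose G := fix G (n : nat) (z : T) {struct n} : R :=
  if n is n'.+1 then Num.min (G n' z) (M n (K n) z)
  else M 0%N (K 0%N) z.
have Gl n : lipc (G n) by elim: n => [|n ih] //=; exact: lip_min.
have G_dec m n z : (m <= n)%N -> G n z <= G m z.
  move=> /subnK <-; elim: (n - m)%N => [|j ih]//=.
  by rewrite ge_min ih.
have G_M n z : G n z <= M n (K n) z.
  by case: n => [|n] //=; rewrite ge_min lexx orbT.
have G_small z d : 0 < d -> exists n, G n z < d.
  move=> d0; have d2 : 0 < d / 2 by rewrite divr_gt0.
  have /cvgrPdist_le/(_ _ d2)[N _ NP] := u0 z.
  exists N; apply: (@le_lt_trans _ _ (d / 2)); last by have := splitr d; lra.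
  apply: (le_trans (G_M N z)); apply: M_le => n Nn.
  by have := NP n Nn; rewrite sub0r normrN ger0_norm.
pose pos (a b : T -> R) z := Num.max (a z - b z) 0.
have posl a b : lipc a -> lipc b -> lipc (pos a b).
  by move=> al bl; apply: lip_max; [exact: lipB|exact: lip_cst].
have LMG N k n : (n <= N)%N ->
    L (pos (M N k) (G n)) <= e / 2 * (1 - (2 ^+ n.+1)^-1).
  (* A maximum starting at [N] is part of a longer maximum starting at [l], and the choice of [K l]
     bounds the mass gained by lengthening the latter. *)
  have key l : (l <= N)%N -> L (pos (M N k) (M l (K l))) <= e / 2 / 2 ^+ l.+1.
    move=> lN; pose K' := maxn (N - l + k).+1 (K l).
    have : L (M l K') - L (M l (K l)) <= e / 2 / 2 ^+ l.+1.
      by rewrite lerBlDl; exact: KP.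
    apply: le_trans; rewrite -pfunB//; apply: pfun_le; [exact: posl|
      exact: lipB|move=> z].
    rewrite ge_max; apply/andP; split.
      rewrite lerD2r; apply: (le_trans (M_tail l N k z lN)).
      by apply: M_mono; rewrite leq_maxl.
    by rewrite subr_ge0; apply: M_mono; rewrite leq_maxr.
  elim: n => [|n ih] nN.
    by apply: (le_trans (key 0%N nN)); rewrite ler_wpM2l ?(ltW e2)//; lra.
  have -> : e / 2 * (1 - (2 ^+ n.+2)^-1) =
      e / 2 * (1 - (2 ^+ n.+1)^-1) + e / 2 / 2 ^+ n.+2.
    have -> : (2 ^+ n.+2 : R)^-1 = (2 ^+ n.+1)^-1 / 2.
      by rewrite exprS invfM mulrC.
    by move: (2 ^+ n.+1)^-1 => t; field.
  (* The positive part of a - min(b, c) is at most the sum of those of a - b and a - c. *)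
  apply: (@le_trans _ _ (L (fun z => pos (M N k) (G n) z +
      pos (M N k) (M n.+1 (K n.+1)) z))).
    apply: pfun_le; [exact: posl|apply: lipD; exact: posl|move=> z].
    rewrite /pos /= ge_max; apply/andP; split; last first.
      by rewrite addr_ge0// le_max lexx orbT.
    have := maxl (M N k z - G n z) 0; have := maxr (M N k z - G n z) 0.
    set a := Num.max _ _ => a0 a1.
    have := maxl (M N k z - M n.+1 (K n.+1) z) 0.
    have := maxr (M N k z - M n.+1 (K n.+1) z) 0.
    set b := Num.max _ _ => b0 b1.
    by rewrite minElt; case: ifP => _; lra.
  rewrite (pfunD HL); [|exact: posl|exact: posl].
  by rewrite lerD// ?ih 1?ltnW// key.
have e3 : 0 < e / 2 / (L (fun=> 1) + 1).
  by rewrite divr_gt0// ltr_wpDl// pfun1_ge0.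
have [N NP] := uniform_of_decreasing Gl G_dec G_small e3.
exists N => // n /= Nn.
rewrite sub0r normrN ger0_norm; last exact: (pfun_ge0 HL).
(* Since [u n] is [M n 0], it is at most its excess over [G n], which has small mass, plus the
   uniformly small [G n]. *)
apply: (@le_trans _ _ (L (fun z => pos (M n 0%N) (G n) z +
    e / 2 / (L (fun=> 1) + 1)))).
  apply: pfun_le => //; first by apply: lipD; [exact: posl|exact: lip_cst].
  move=> z; have := maxl (M n 0 z - G n z) 0.
  rewrite -/(pos (M n 0) (G n) z) /=.
  by have := le_trans (G_dec _ _ z Nn) (ltW (NP z)); lra.
rewrite (pfunD HL); [|exact: posl|exact: lip_cst].
rewrite pfun_cst [leRHS](splitr e) lerD//.
  apply: (le_trans (LMG n 0%N n (leqnn n))).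
  by rewrite ler_piMr// ?(ltW e2)// gerBl invr_ge0 exprn_ge0.
have L1 : L (fun=> 1) + 1 != 0 by rewrite gt_eqF// ltr_wpDl// pfun1_ge0.
by rewrite -[leRHS](divfK L1) ler_pM2l// lerDl.
Qed.

End PositiveFunctional.

(** * Dyadic kernels and atoms *)

Section DyadicKernel.
Context {R : realType}.
Local Notation T := (circle R).
Implicit Types (i : nat) (s t z k : T) (y : R[i]).

(** With dyadic lengths the mean is a product: each doubling multiplies it by (1 + y^(2^i)) / 2, of
    modulus at most 1 on the circle. Hence the kernels are monotone in [i]. *)
Definition dyadic_mean i y : R[i] := (2 ^+ i)^-1 * \sum_(h < 2 ^ i) y ^+ h.

(** A Fejér kernel, normalised to be 1 at y = 1 instead of having mean 1. *)
Definition dyadic_kernel i y : R := sqmod (dyadic_mean i y).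

Lemma dyadic_mean0 y : dyadic_mean 0 y = 1.
Proof. by rewrite /dyadic_mean expr0 invr1 mul1r big_ord1 expr0. Qed.

Lemma dyadic_mean1 i : dyadic_mean i 1 = 1.
Proof.
rewrite /dyadic_mean (eq_bigr (fun=> 1)) => [|h _]; last by rewrite expr1n.
by rewrite sumr_const card_ord natrX mulVf// expf_neq0// pnatr_eq0.
Qed.

Lemma dyadic_meanS i y :
  dyadic_mean i.+1 y = dyadic_mean i y * ((1 + y ^+ (2 ^ i)) / 2).
Proof.
rewrite /dyadic_mean exprS invfM -!mulrA mulrCA; congr (_ * _).
have -> : (2 ^ i.+1 = 2 ^ i + 2 ^ i)%N by rewrite expnS mul2n addnn.
rewrite big_split_ord /= mulrA [RHS]mulrC; congr (_ * _).
rewrite mulrDr mulr1; congr (_ + _); rewrite mulr_suml.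
by apply: eq_bigr => h _; rewrite exprD mulrC.
Qed.

Lemma dyadic_mean_geo i y :
  (1 - y) * dyadic_mean i y = (2 ^+ i)^-1 * (1 - y ^+ (2 ^ i)).
Proof.
rewrite /dyadic_mean mulrCA; congr (_ * _).
by rewrite -opprB mulNr -subrX1 opprB.
Qed.

Lemma dyadic_kernel_ge0 i y : 0 <= dyadic_kernel i y.
Proof. exact: sqmod_ge0. Qed.

Lemma dyadic_kernel1 i : dyadic_kernel i 1 = 1.
Proof. by rewrite /dyadic_kernel dyadic_mean1 -sqr_cmod cmod1 expr1n. Qed.

Lemma sqmod_le4 (x y : R[i]) : cmod x = 1 -> cmod y = 1 -> sqmod (x - y) <= 4.
Proof.
move=> x1 y1; rewrite -sqr_cmod (_ : 4 = 2 ^+ 2); last by rewrite -natrX.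
rewrite ler_sqr ?nnegrE ?cmod_ge0//.
by rewrite (le_trans (cmodD _ _))// cmodN x1 y1.
Qed.

Lemma sqmod_pow2V i : sqmod ((2 ^+ i)^-1 : R[i]) = (4 ^+ i)^-1.
Proof.
rewrite -sqr_cmod cmodV cmodX -[2 in LHS](rmorph_nat (real_complex R) 2).
by rewrite cmod_real ger0_norm// exprVn -exprM mulnC exprM -[2 ^+ 2]natrX.
Qed.

Lemma dyadic_kernel_noninc y m n : cmod y = 1 -> (m <= n)%N ->
  dyadic_kernel n y <= dyadic_kernel m y.
Proof.
move=> y1 /subnK <-; elim: (n - m)%N => [|j ih]//=.
rewrite addSn /dyadic_kernel dyadic_meanS sqmodM (le_trans _ ih)//.
rewrite ler_piMr ?sqmod_ge0// sqmodM -[2 in X in _ * X]expr1 sqmod_pow2V expr1.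
rewrite ler_pdivrMr// mul1r -[y ^+ _]opprK; apply: sqmod_le4.
  exact: cmod1.
by rewrite cmodN cmodX y1 expr1n.
Qed.

Lemma dyadic_kernel_le1 i y : cmod y = 1 -> dyadic_kernel i y <= 1.
Proof.
move=> y1; apply: (le_trans (dyadic_kernel_noninc y1 (leq0n i))).
by rewrite /dyadic_kernel dyadic_mean0 -sqr_cmod cmod1 expr1n.
Qed.

Lemma dyadic_mean_le1 i y : cmod y = 1 -> cmod (dyadic_mean i y) <= 1.
Proof.
move=> y1; rewrite -(@ler_sqr _ _ 1) ?nnegrE ?cmod_ge0// sqr_cmod expr1n.
exact: dyadic_kernel_le1.
Qed.

(** Summation of the geometric series. The explicit rate is needed when the centre of the kernel
    moves with [i]. *)
Lemma dyadic_kernel_bound i y : cmod y = 1 ->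
  dyadic_kernel i y * sqmod (1 - y) <= 4 * (4 ^+ i)^-1.
Proof.
move=> y1; rewrite -sqmodM mulrC dyadic_mean_geo sqmodM sqmod_pow2V mulrC.
rewrite ler_pM2r ?invr_gt0 ?exprn_gt0//; apply: sqmod_le4.
  exact: cmod1.
by rewrite cmodX y1 expr1n.
Qed.

Lemma cvg_pow4V : (4 * (4 ^+ i)^-1 : R) @[i --> \oo] --> (0 : R).
Proof.
rewrite -[0](mulr0 4); apply: cvgMr.
under eq_fun do rewrite -exprVn.
by apply: cvg_expr; rewrite ger0_norm// invf_lt1 ?ltr1n.
Qed.

Lemma cvg_dyadic_kernel y : cmod y = 1 -> y != 1 ->
  dyadic_kernel i y @[i --> \oo] --> (0 : R).
Proof.
move=> y1 yn1; have d0 : 0 < sqmod (1 - y).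
  by rewrite lt_def sqmod_ge0 sqmod_eq0 subr_eq0 eq_sym yn1.
apply: (@squeeze_cvgr _ _ _ _ (cst 0)
    (fun i => (4 * (4 ^+ i)^-1) * (sqmod (1 - y))^-1)).
- near=> i; rewrite dyadic_kernel_ge0 ler_pdivlMr//.
  exact: dyadic_kernel_bound.
- exact: cvg_cst.
- by rewrite -[0](mul0r (sqmod (1 - y))^-1); apply: cvgMl; exact: cvg_pow4V.
Unshelve. all: by end_near. Qed.

Lemma cvg_dyadic_mean y : cmod y = 1 -> y != 1 ->
  cmod (dyadic_mean i y) @[i --> \oo] --> (0 : R).
Proof.
move=> y1 yn1; rewrite -sqrtr0.
under eq_fun do rewrite /cmod.
by apply: (continuous_cvg _ (@sqrt_continuous R 0)); exact: cvg_dyadic_kernel.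
Qed.

Lemma clip_dyadic_mean i k : clip cdist (fun t => dyadic_mean i (cval t / cval k)).
Proof.
apply: clipZ; apply: clip_sum => h.
by apply: clipX; apply: clipM; [exact: clip_val|exact: clip_cst].
Qed.

Lemma lip_dyadic_kernel i k : lip cdist (fun t => dyadic_kernel i (cval t / cval k)).
Proof. exact/lip_sqmod/clip_dyadic_mean. Qed.

Lemma lip_dyadic_kernel2 i :
  lip cdist2 (fun p : T * T => dyadic_kernel i (cval p.2 / cval p.1)).
Proof.
apply: lip_sqmod; apply: clipZ; apply: clip_sum => h.
apply: clipX; apply: clipM; first exact: (clip_snd clip_val).
under eq_fun do rewrite -circle_conj.
exact: (clip_fst (clip_conj clip_val)).
Qed.

Lemma circle_ratio s t : cmod (cval s / cval t) = 1.
Proof. exact: (circle_cmod (circle_div s t)). Qed.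

Lemma circle_ratio_neq1 s t : s != t -> cval s / cval t != 1.
Proof.
apply: contraNneq => st1; apply/eqP/val_inj => /=.
by rewrite -[LHS](divfK (circle_neq0 t)) st1 mul1r.
Qed.

(* Squared modulus of the multiplier of f |-> f - \sum_(k <- S) F_k, where F_k
   is the local average of f at the frequency k ([local_mean] below). *)
Definition residual S i t : R :=
  sqmod (1 - \sum_(k <- S) dyadic_mean i (cval t / cval k)).

Definition residual_error S i t : R :=
  \sum_(k <- S | k != t) cmod (dyadic_mean i (cval t / cval k)).

Lemma cvg_residual_error S t :
  residual_error S i t @[i --> \oo] --> (0 : R).
Proof.
rewrite [X in _ --> X](_ : 0 = \sum_(k <- S | k != t) 0 :> R); last by rewrite big1.
apply: cvg_big; [exact: add_continuous|move=> k kt].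
apply: cvg_dyadic_mean; first exact: circle_ratio.
by apply: circle_ratio_neq1; rewrite eq_sym.
Qed.

Lemma residual_error_ge0 S i t : 0 <= residual_error S i t.
Proof. by apply: sumr_ge0 => k _; exact: cmod_ge0. Qed.

Lemma residual_ge0 S i t : 0 <= residual S i t.
Proof. exact: sqmod_ge0. Qed.

(** If [t] is in [S], the summand k = t equals 1 and cancels the leading 1; the other summands form
    [residual_error]. In the limit the residual is thus the indicator of the complement of [S]. *)
Lemma residual_le S i t : uniq S ->
  residual S i t <= ((t \notin S)%:R + residual_error S i t) ^+ 2.
Proof.
move=> uS; rewrite /residual -sqr_cmod ler_sqr ?nnegrE ?cmod_ge0//; last first.
  by rewrite addr_ge0// residual_error_ge0.
rewrite (bigID (fun k => k == t)) /=.
have -> : \sum_(k <- S | k == t) dyadic_mean i (cval t / cval k) =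
    (t \in S)%:R.
  rewrite (eq_bigr (fun=> 1)); last first.
    by move=> k /eqP ->; rewrite divff ?circle_neq0// dyadic_mean1.
  by rewrite big_const_seq -(@eq_count _ (pred1 t))// count_uniq_mem//;
    case: (t \in S); rewrite /= ?addr0.
rewrite opprD addrA (le_trans (cmodD _ _))// lerD//.
  by case: (t \in S); rewrite ?subrr ?cmod0// subr0 cmod1.
by rewrite cmodN cmod_sum.
Qed.

Lemma residual_bound S i t : residual S i t <= (1 + (size S)%:R) ^+ 2.
Proof.
rewrite /residual -sqr_cmod ler_sqr ?nnegrE ?cmod_ge0//.
rewrite (le_trans (cmodD _ _))// cmodN cmod1 lerD2l.
rewrite (le_trans (cmod_sum _ _ _))//.
rewrite -sum1_size natr_sum ler_sum// => k _.
exact/dyadic_mean_le1/circle_ratio.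
Qed.

Lemma lip_residual S i : lip cdist (residual S i).
Proof.
apply: lip_sqmod; apply: clipB; first exact: clip_cst.
by apply: clip_sum => k; exact: clip_dyadic_mean.
Qed.

End DyadicKernel.

Section Sequences.
Context {R : realType}.
Implicit Types a u : nat -> R.

Lemma cvgn_ge u l c : u n @[n --> \oo] --> l -> (forall n, c <= u n) -> c <= l.
Proof.
move=> ul cu; rewrite -(cvg_lim _ ul)//; apply: limr_ge.
  by apply/cvg_ex; exists l.
exact: nearW.
Qed.

Lemma cvgn_le u l c : u n @[n --> \oo] --> l ->
  (\forall n \near \oo, u n <= c) -> l <= c.
Proof.
move=> ul cu; rewrite -(cvg_lim _ ul)//; apply: limr_le => //.
by apply/cvg_ex; exists l.
Qed.

Lemma cvg_sqrD a b : a n @[n --> \oo] --> (0 : R) ->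
  (b + a n) ^+ 2 @[n --> \oo] --> b ^+ 2.
Proof.
move=> a0; have h : b + a n @[n --> \oo] --> b.
  by rewrite -[X in _ --> X]addr0; apply: cvgD => //; exact: cvg_cst.
by rewrite expr2; under eq_fun do rewrite expr2; exact: cvgM.
Qed.

Lemma cvg_lip (u : circle R -> R) (s : nat -> circle R) t : lip cdist u ->
  cdist (s n) t @[n --> \oo] --> (0 : R) ->
  u (s n) @[n --> \oo] --> u t.
Proof.
move=> [[C C0 uC] _] st; apply: (@squeeze_cvgr _ _ _ _
    (fun n => u t - C * cdist (s n) t) (fun n => u t + C * cdist (s n) t)).
- by near=> n; rewrite -ler_distlC distrC.
- rewrite -[X in _ --> X](subr0 (u t)) -(mulr0 C).
  by apply: cvgB; [exact: cvg_cst|exact: cvgMr].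
- rewrite -[X in _ --> X](addr0 (u t)) -(mulr0 C).
  by apply: cvgD; [exact: cvg_cst|exact: cvgMr].
Unshelve. all: by end_near. Qed.

End Sequences.

(** * Point masses of a positive functional *)

Section Atoms.
Context {R : realType}.
Local Notation T := (circle R).
Local Notation lipc := (@lip R T cdist).
Implicit Types (i : nat) (s t k : T) (S : seq T).

Variable L : (T -> R) -> R.
Hypothesis HL : positive_functional L.

(** A one-sided form of dominated convergence: if the pointwise upper limit of [v n] is at most [w],
    bounded convergence applies to the positive parts of v n - w. *)
Lemma pfun_pos_cvg (v : nat -> T -> R) (w : T -> R) C : lipc w ->
  (forall n, lipc (v n)) -> (forall n t, v n t - w t <= C) -> 0 <= C ->
  (forall t, exists2 a : nat -> R, (forall n, v n t <= w t + a n) &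
     a n @[n --> \oo] --> (0 : R)) ->
  forall e, 0 < e -> \forall n \near \oo, L (v n) <= L w + e.
Proof.
move=> wl vl vC C0 va e e0.
pose p n t := Num.max (v n t - w t) 0.
have pl n : lipc (p n) by apply: lip_max; [exact: lipB|exact: lip_cst].
have p_ge0 n t : 0 <= p n t by rewrite le_max lexx orbT.
have p_cvg t : p n t @[n --> \oo] --> (0 : R).
  have [a av a0] := va t.
  apply: (@squeeze_cvgr _ _ _ _ (cst 0) (fun n => `|a n|)).
  - near=> n; rewrite p_ge0 /p ge_max normr_ge0 andbT.
    by rewrite lerBlDl (le_trans (av n))// lerD2l ler_norm.
  - exact: cvg_cst.
  - by rewrite -(@normr0 _ R); apply: cvg_norm.
have pC n t : 0 <= p n t <= C by rewrite p_ge0 /p ge_max vC.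
have /cvgrPdist_le/(_ e e0) := bounded_convergence HL pl pC p_cvg.
apply: filterS => n; rewrite sub0r normrN => /(le_trans (ler_norm _)) Lp.
apply: (@le_trans _ _ (L (fun t => w t + p n t))).
  apply: (pfun_le HL) => //; first exact: lipD.
  by move=> t; rewrite -lerBlDl /p le_max lexx.
by rewrite (pfunD HL)// lerD2l.
Unshelve. all: by end_near. Qed.

Definition kernel_mass i k : R :=
  L (fun t => dyadic_kernel i (cval t / cval k)).

(* [dyadic_kernel i (t / k)] decreases to the indicator function of [k], so that
   this is the mass of [k]. *)
Definition atom k : R := limn (fun i => kernel_mass i k).

Lemma kernel_mass_ge0 i k : 0 <= kernel_mass i k.
Proof.
apply: (pfun_ge0 HL) => [|t]; first exact: lip_dyadic_kernel.
exact: dyadic_kernel_ge0.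
Qed.

Lemma kernel_mass_noninc k : nonincreasing_seq (fun i => kernel_mass i k).
Proof.
move=> m n mn; apply: (pfun_le HL) => [||t]; try exact: lip_dyadic_kernel.
by apply: dyadic_kernel_noninc => //; exact: circle_ratio.
Qed.

Lemma cvg_kernel_mass k : kernel_mass i k @[i --> \oo] --> atom k.
Proof.
apply: nonincreasing_is_cvgn; first exact: kernel_mass_noninc.
by exists 0 => _ [i _ <-]; exact: kernel_mass_ge0.
Qed.

Lemma cvg_sum_kernel_mass S :
  \sum_(k <- S) kernel_mass i k @[i --> \oo] --> \sum_(k <- S) atom k.
Proof.
apply: cvg_big => [|k _]; [exact: add_continuous|exact: cvg_kernel_mass].
Qed.

Lemma sum_kernel_le S i t : uniq S ->
  \sum_(k <- S) dyadic_kernel i (cval t / cval k) <=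
  1 + residual_error S i t.
Proof.
move=> uS; rewrite (bigID (fun k => k == t)) /=; apply: lerD.
  rewrite (eq_bigr (fun=> 1)); last first.
    by move=> k /eqP ->; rewrite divff ?circle_neq0// dyadic_kernel1.
  rewrite big_const_seq -(@eq_count _ (pred1 t))// count_uniq_mem//.
  by case: (t \in S); rewrite /= ?addr0.
apply: ler_sum => k _; rewrite /dyadic_kernel -sqr_cmod expr2.
by rewrite ler_piMr ?cmod_ge0// dyadic_mean_le1// circle_ratio.
Qed.

(** Kernels centred at distinct points have pointwise sum at most 1 + o(1). *)
Lemma sum_atom_le S : uniq S -> \sum_(k <- S) atom k <= L (fun=> 1).
Proof.
move=> uS; apply/ler_addgt0Pr => e e0.
pose v i t := \sum_(k <- S) dyadic_kernel i (cval t / cval k).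
have vl i : lipc (v i) by apply: lip_sum => k; exact: lip_dyadic_kernel.
have : \forall i \near \oo, L (v i) <= L (fun=> 1) + e.
  apply: (@pfun_pos_cvg v _ (size S)%:R) => //.
  - exact: lip_cst.
  - move=> i t; rewrite lerBlDr (@le_trans _ _ (size S)%:R) ?lerDl//.
    rewrite /v -sum1_size natr_sum ler_sum// => k _.
    exact/dyadic_kernel_le1/circle_ratio.
  - move=> t; exists (fun i => residual_error S i t).
      by move=> i; exact: sum_kernel_le.
    exact: cvg_residual_error.
move=> vle; have h := @cvg_sum_kernel_mass S; apply: (cvgn_le h).
apply: filterS vle => i; rewrite (pfun_sum HL)// => k.
exact: lip_dyadic_kernel.
Qed.

(** [S0] attains the supremum of the finite sums of atoms up to [e]; a disjoint list of larger mass
    could be appended to it. *)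
Lemma atom_tail e : 0 < e -> exists2 S0, uniq S0 &
  forall S, uniq S -> {in S, forall k, k \notin S0} ->
    \sum_(k <- S) atom k <= e.
Proof.
move=> e0; pose A := [set \sum_(k <- S) atom k | S in [set S | uniq S]].
have supA : has_sup A.
  split; first by exists (\sum_(k <- [::]) atom k), [::].
  by exists (L (fun=> 1)) => _ [S uS <-]; exact: sum_atom_le.
have [_ [S0 uS0 <-] S0P] := sup_adherent e0 supA.
exists S0 => // S uS disj.
have : \sum_(k <- S0 ++ S) atom k <= sup A.
  apply: ub_le_sup; [by case: supA|exists (S0 ++ S) => //=].
  rewrite cat_uniq uS0 uS andbT /=.
  by apply/hasPn => k /disj.
by rewrite big_cat /=; move: S0P; lra.
Qed.

Lemma near_residual_le S e : uniq S -> 0 < e ->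
  \forall i \near \oo, L (residual S i) <= L (fun=> 1) + e.
Proof.
move=> uS; apply: (@pfun_pos_cvg _ _ ((1 + (size S)%:R) ^+ 2)).
- exact: lip_cst.
- by move=> i; exact: lip_residual.
- by move=> i t; rewrite lerBlDr (le_trans (residual_bound _ _ _))// lerDl.
- exact: sqr_ge0.
move=> t; exists (fun i => (1 + residual_error S i t) ^+ 2 - 1).
  move=> i; rewrite addrC subrK (le_trans (residual_le _ _ uS))//.
  rewrite ler_sqr ?nnegrE ?addr_ge0 ?residual_error_ge0// lerD2r.
  by case: (t \in S).
rewrite -(subrr (1 : R)); apply: cvgB; last exact: cvg_cst.
rewrite -[X in _ --> X](expr1n _ 2).
by apply: cvg_sqrD; exact: cvg_residual_error.
Qed.

(* Let [l] be a cluster point of nearly maximizing [s]. The kernel concentrates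
   at [l], where the residual vanishes if [l] is in [S], while the mass of [l] is
   small otherwise. *)
Lemma near_sup_residual_kernel S e : uniq S ->
  (forall k, k \notin S -> atom k <= e) -> 0 < e ->
  \forall i \near \oo, forall s,
    L (fun t => residual S i t * dyadic_kernel i (cval t / cval s)) <= 2 * e.
Proof.
move=> uS tailS e0; apply: contrapT => nH.
have ex n : exists p : nat * T, (n <= p.1)%N /\
    2 * e < L (fun t => residual S p.1 t * dyadic_kernel p.1 (cval t / cval p.2)).
  apply: contrapT => /forallNP np; apply: nH; exists n => // i ni s.
  by rewrite leNgt; apply/negP => lt; apply: (np (i, s)).
have {ex} /choice[p pP] := ex.
have [l lP] := circle_cluster (fun n => (p n).2).
have ex n : exists j, (n <= j)%N /\ cdist (p j).2 l < n.+1%:R^-1.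
  by have [|j nj jl] := lP n.+1%:R^-1 _ n; [rewrite invr_gt0|exists j].
have {ex} /choice[phi phiP] := ex.
pose I n := (p (phi n)).1; pose s n := (p (phi n)).2.
have nI n : (n <= I n)%N.
  by have [h _] := phiP n; exact: leq_trans h (pP (phi n)).1.
have sl : cdist (s n) l @[n --> \oo] --> (0 : R).
  apply: (@squeeze_cvgr _ _ _ _ (cst 0) (@harmonic R)).
  - by near=> n; rewrite cdist_ge0 ltW//; case: (phiP n).
  - exact: cvg_cst.
  - exact: cvg_harmonic.
pose v n t := residual S (I n) t * dyadic_kernel (I n) (cval t / cval (s n)).
have v_gt n : 2 * e < L (v n) by case: (pP (phi n)).
have vl n : lipc (v n).
  by apply: lipM; [exact: lip_residual|exact: lip_dyadic_kernel].
pose b : R := (l \notin S)%:R.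
pose C := (1 + (size S)%:R : R) ^+ 2.
have v_ge0 n t : 0 <= v n t by rewrite mulr_ge0 ?residual_ge0 ?dyadic_kernel_ge0.
have vK n t : v n t <= C * dyadic_kernel (I n) (cval t / cval (s n)).
  by rewrite ler_wpM2r ?dyadic_kernel_ge0// residual_bound.
have vC n t : v n t <= C.
  apply: (le_trans (vK n t)); rewrite ler_piMr ?sqr_ge0//.
  exact/dyadic_kernel_le1/circle_ratio.
(* The pointwise upper limit of [v n] is at most [b] at [l] and 0 elsewhere, hence below [b] times
   the kernel of any fixed order [m] at [l]. Letting [m] grow yields 2 * e <= b * atom L l, which
   contradicts the hypothesis on atoms outside [S]. *)
have key m : 2 * e <= b * kernel_mass m l.
  apply/ler_addgt0Pr => d d0.
  pose w t := b * dyadic_kernel m (cval t / cval l).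
  have wl : lipc w by apply: lipZ; exact: lip_dyadic_kernel.
  have -> : b * kernel_mass m l = L w.
    by rewrite -(pfunZ HL)//; exact: lip_dyadic_kernel.
  have w_ge0 t : 0 <= w t by rewrite mulr_ge0// dyadic_kernel_ge0.
  have : \forall n \near \oo, L (v n) <= L w + d.
    apply: (@pfun_pos_cvg v w C) => //.
    - by move=> n t; rewrite lerBlDr (le_trans (vC _ _))// lerDl.
    - exact: sqr_ge0.
    move=> t; have [->|tl] := eqVneq t l.
      exists (fun n => (b + residual_error S (I n) l) ^+ 2 - b).
        move=> n; rewrite /w divff ?circle_neq0// dyadic_kernel1 mulr1.
        rewrite addrC subrK (le_trans _ (residual_le _ _ uS))//.
        rewrite /v ler_piMr ?residual_ge0//.
        exact/dyadic_kernel_le1/circle_ratio.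
      have bb : b ^+ 2 = b by rewrite /b; case: (l \notin S); rewrite ?expr1n ?expr0n.
      rewrite -(subrr b); apply: cvgB; last exact: cvg_cst.
      have Io : I n @[n --> \oo] --> \oo.
        by apply/cvgnyPge => A; exists A => // n /= An; exact: leq_trans An (nI n).
      rewrite -[X in _ --> X]bb; apply: cvg_sqrD.
      exact: cvg_comp Io (cvg_residual_error S l).
    (* The kernel bound divides by the squared distance from [t] to the moving centre [s n]; this
       stays away from 0 because [s n] tends to [l] and [t] differs from [l]. *)
    pose g (x : T) := sqmod (cval x - cval t).
    have gl : lipc g.
      by apply: lip_sqmod; apply: clipB; [exact: clip_val|exact: clip_cst].
    have g0 : g l != 0.
      rewrite /g sqmod_eq0 subr_eq0; apply: contra_neq tl => h.
      by apply: val_inj.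
    exists (v^~ t) => [n|]; first by rewrite lerDr.
    have gs : g (s n) @[n --> \oo] --> g l by exact: cvg_lip.
    apply: (@squeeze_cvgr _ _ _ _ (cst 0)
        (fun n => C * ((4 * (4 ^+ n)^-1) * (g (s n))^-1))).
    - near=> n; rewrite v_ge0 /= (le_trans (vK n t))// ler_wpM2l ?sqr_ge0//.
      rewrite ler_pdivlMr; last first.
        rewrite lt_def sqmod_ge0 andbT.
        by near: n; exact: cvgr_neq0 gs g0.
      apply: (@le_trans _ _ (4 * (4 ^+ I n)^-1)); last first.
        rewrite ler_pM2l// lef_pV2 ?posrE ?exprn_gt0//.
        by rewrite ler_weXn2l// ler1n.
      apply: le_trans (dyadic_kernel_bound (I n) (circle_ratio t (s n))).
      rewrite ler_wpM2l ?dyadic_kernel_ge0//.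
      rewrite -[leRHS]mul1r -(circle_sqmod (s n)) -sqmodM.
      by rewrite mulrBr mulr1 mulrCA divff ?circle_neq0// mulr1.
    - exact: cvg_cst.
    - rewrite -(mulr0 C) -(mul0r (g l)^-1); apply: cvgMr.
      apply: cvgM; first exact: cvg_pow4V.
      exact: cvgV.
  case=> N _ /(_ N (leqnn N)); rewrite /=.
  by have := v_gt N; lra.
have h : 2 * e <= b * atom l.
  apply: (@cvgn_ge _ (fun m => b * kernel_mass m l)) => //.
  by apply: cvgMr; exact: cvg_kernel_mass.
move: h; rewrite /b; have := tailS l; case: (l \in S) => /=.
  by rewrite mul0r; lra.
by move=> /(_ isT); rewrite mul1r; lra.
Unshelve. all: by end_near. Qed.

End Atoms.

(** * The large sieve inequality *)

Lemma weighted_cauchy_schwarz {R : realType} (I : Type) (r : seq I)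
    (w x : I -> R) : (forall n, 0 <= w n) ->
  (\sum_(n <- r) w n * x n) ^+ 2 <=
  (\sum_(n <- r) w n) * \sum_(n <- r) w n * x n ^+ 2.
Proof.
move=> w0; set X := \sum_(n <- r) _ * x n; set A := \sum_(n <- r) w n.
set Q := \sum_(n <- r) _.
have key y : 0 <= A * y ^+ 2 - 2 * y * X + Q.
  have -> : A * y ^+ 2 - 2 * y * X + Q = \sum_(n <- r) w n * (y - x n) ^+ 2.
    rewrite mulr_suml mulr_sumr -sumrB -big_split /=.
    by apply: eq_bigr => n _; ring.
  by apply: sumr_ge0 => n _; rewrite mulr_ge0// sqr_ge0.
have A0 : 0 <= A by apply: sumr_ge0.
move: A0; rewrite le_eqVlt => /predU1P[A0|A0].
  rewrite -A0 mul0r; suff -> : X = 0 by rewrite expr0n.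
  (* For A = 0 the quadratic degenerates to an affine function, which takes the value -1 at this
     point. *)
  apply/eqP/negPn/negP => X0; have := key ((Q + 1) / (2 * X)).
  rewrite -A0 mul0r add0r.
  have -> : 2 * ((Q + 1) / (2 * X)) * X = Q + 1 by field.
  by lra.
have := key (X / A); have -> : A * (X / A) ^+ 2 - 2 * (X / A) * X + Q =
    (A * Q - X ^+ 2) / A by field; rewrite gt_eqF.
by rewrite pmulr_lge0 ?invr_gt0// subr_ge0.
Qed.

Section IteratedFunctional.
Context {R : realType}.
Local Notation T := (circle R).
Local Notation lipc := (@lip R T cdist).
Variable L : (T -> R) -> R.
Hypothesis HL : positive_functional L.
Implicit Types f g : T * T -> R.

(** Replaces integration against the product measure; the order of integration is fixed, so no
    Fubini theorem is involved. *)
Definition pfun2 f : R := L (fun s => L (fun t => f (s, t))).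

Lemma pfun2D f g : lip cdist2 f -> lip cdist2 g ->
  pfun2 (fun p => f p + g p) = pfun2 f + pfun2 g.
Proof.
move=> fl gl; rewrite /pfun2 -(pfunD HL);
  [|exact: (lip_pfun HL fl)|exact: (lip_pfun HL gl)].
by congr L; apply/funext => s; rewrite (pfunD HL)//;
  [exact: (lip_section s fl)|exact: (lip_section s gl)].
Qed.

Lemma pfun2Z c f : lip cdist2 f -> pfun2 (fun p => c * f p) = c * pfun2 f.
Proof.
move=> fl; rewrite /pfun2 -(pfunZ HL); last exact: (lip_pfun HL fl).
by congr L; apply/funext => s; rewrite (pfunZ HL)//; exact: (lip_section s fl).
Qed.

Lemma pfun2_le f g : lip cdist2 f -> lip cdist2 g ->
  (forall s t, f (s, t) <= g (s, t)) -> pfun2 f <= pfun2 g.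
Proof.
move=> fl gl fg; apply: (pfun_le HL).
- exact: (lip_pfun HL fl).
- exact: (lip_pfun HL gl).
move=> s; apply: (pfun_le HL) => //; first exact: (lip_section s fl).
exact: (lip_section s gl).
Qed.

Lemma pfun2_sum I (r : seq I) (F : I -> T * T -> R) :
  (forall i, lip cdist2 (F i)) ->
  pfun2 (fun p => \sum_(i <- r) F i p) = \sum_(i <- r) pfun2 (F i).
Proof.
move=> Fl; rewrite /pfun2 -(pfun_sum HL); last by move=> i; exact: (lip_pfun HL (Fl i)).
congr L; apply/funext => s; rewrite (pfun_sum HL)// => i.
exact: (lip_section s (Fl i)).
Qed.

Lemma pfun2_prod (f g : T -> R) : lipc f -> lipc g ->
  pfun2 (fun p => f p.1 * g p.2) = L f * L g.
Proof.
move=> fl gl; rewrite /pfun2 mulrC -(pfunZ HL)//.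
by congr L; apply/funext => s /=; rewrite (pfunZ HL)// mulrC.
Qed.

Lemma positive_functional_weight (q : T -> R) : lipc q ->
  (forall t, 0 <= q t) -> positive_functional (fun u => L (fun t => q t * u t)).
Proof.
move=> ql q0; split=> [u v ul vl|c u ul|u ul u0].
- rewrite -(pfunD HL); try exact: lipM.
  by congr L; apply/funext => t; rewrite mulrDr.
- rewrite -(pfunZ HL); last exact: lipM.
  by congr L; apply/funext => t; rewrite mulrCA.
- by apply: (pfun_ge0 HL) => [|t]; [exact: lipM|rewrite mulr_ge0].
Qed.

End IteratedFunctional.

(** Counting measure on a finite set, for which the large sieve becomes a Bessel inequality. *)
Lemma positive_functional_sum {R : realType} (S : seq (circle R)) :
  positive_functional (fun u : circle R -> R => \sum_(k <- S) u k).
Proof.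
split=> [u v _ _|c u _|u _ u0]; first by rewrite big_split.
  by rewrite mulr_sumr.
exact: sumr_ge0.
Qed.

Section LargeSieve.
Context {R : realType}.
Local Notation T := (circle R).
Implicit Types (s : seq int) (u w : int -> R).

(** The positive exponent is the convention under which convolution by [w] is the Fourier multiplier
    with this symbol, see [has_symbol_shift]. *)
Definition wtransform s w (z : T) : R[i] :=
  \sum_(n <- s) (w n)%:C * cval z ^ n.

Lemma clip_wtransform s w : clip cdist (wtransform s w).
Proof.
by apply: clip_sum => n; apply: clipZ; exact: clip_exprz.
Qed.

Lemma clip_wtransform_div s w :
  clip cdist2 (fun p : T * T => wtransform s w (circle_div p.1 p.2)).
Proof. by have [h1 h2] := clip_wtransform s w; split; [exact: (lip_div h1)|exact: (lip_div h2)]. Qed.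

Lemma wtransform_le s u w z : (forall n, 0 <= u n <= w n) ->
  cmod (wtransform s u z) <= \sum_(n <- s) w n.
Proof.
move=> uw; apply: (le_trans (cmod_sum _ _ _)); apply: ler_sum => n _.
rewrite cmodM cmod_real circle_exprz mulr1.
by have /andP[u0 ?] := uw n; rewrite ger0_norm.
Qed.

(** Duality: the integral of |v|^2, for v the transform of [u], is the sum of [u n] times the real
    part [a n] of the integral of z^n conj(v). Cauchy-Schwarz with weights [w n] leaves a sum of w n
    * a n ^+ 2; its expansion as a double integral contains the transform of [w] at s / t. *)
Lemma large_sieve (L : (T -> R) -> R) s u w : positive_functional L ->
  (forall n, 0 <= u n <= w n) ->
  L (fun z => sqmod (wtransform s u z)) ^+ 2 <= (\sum_(n <- s) w n) *
  pfun2 L (fun p => cmod (wtransform s u p.1) * cmod (wtransform s u p.2) *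
    cmod (wtransform s w (circle_div p.1 p.2))).
Proof.
move=> HL uw.
have w0 n : 0 <= w n by have /andP[] := uw n; exact: le_trans.
set v := wtransform s u.
have vl : clip cdist v := clip_wtransform s u.
pose g n z : R[i] := cval z ^ n * (v z)^*%C.
have gl n : clip cdist (g n).
  by apply: clipM; [exact: clip_exprz|exact: clip_conj].
have gr n : lip cdist (fun z => complex.Re (g n z)) by case: (gl n).
have gi n : lip cdist (fun z => complex.Im (g n z)) by case: (gl n).
pose a n := L (fun z => complex.Re (g n z)).
pose b n := L (fun z => complex.Im (g n z)).
have -> : L (fun z => sqmod (v z)) = \sum_(n <- s) u n * a n.
  under [RHS]eq_bigr do rewrite -(pfunZ HL)//.
  rewrite -(pfun_sum HL); last by move=> n; exact: lipZ.
  congr L; apply/funext => z.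
  under eq_bigr do rewrite -ReZ.
  rewrite -Re_sum; under eq_bigr do rewrite mulrA.
  by rewrite -mulr_suml mulcJ.
apply: (@le_trans _ _ ((\sum_(n <- s) w n * `|a n|) ^+ 2)).
  rewrite -[leLHS]real_normK ?num_real// ler_sqr ?nnegrE//; last first.
    by apply: sumr_ge0 => n _; rewrite mulr_ge0.
  apply: (le_trans (ler_norm_sum _ _ _)); apply: ler_sum => n _.
  rewrite normrM ler_wpM2r//.
  by have /andP[u0 ?] := uw n; rewrite ger0_norm.
apply: (le_trans (weighted_cauchy_schwarz _ _ w0)).
rewrite ler_wpM2l ?sumr_ge0//.
(* The square of the imaginary part [b n] is added to that of [a n]: the integrand becomes the real
   part of a product, and the sum over [n] collapses to a transform of [w]. *)
pose h n (p : T * T) := w n * (complex.Re (g n p.1) * complex.Re (g n p.2) +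
  complex.Im (g n p.1) * complex.Im (g n p.2)).
have hl n : lip cdist2 (h n).
  apply: lipZ; apply: lipD; apply: lipM; rewrite ?[lip _ _]/=.
  - exact: (lip_fst (gr n)).
  - exact: (lip_snd (gr n)).
  - exact: (lip_fst (gi n)).
  - exact: (lip_snd (gi n)).
apply: (@le_trans _ _ (\sum_(n <- s) pfun2 L (h n))).
  apply: ler_sum => n _; rewrite /h (pfun2Z HL); last first.
    apply: lipD; apply: lipM.
    - exact: (lip_fst (gr n)).
    - exact: (lip_snd (gr n)).
    - exact: (lip_fst (gi n)).
    - exact: (lip_snd (gi n)).
  rewrite (pfun2D HL); last first.
  - by apply: lipM; [exact: (lip_fst (gi n))|exact: (lip_snd (gi n))].
  - by apply: lipM; [exact: (lip_fst (gr n))|exact: (lip_snd (gr n))].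
  rewrite (@pfun2_prod _ _ HL _ _ (gr n) (gr n)).
  rewrite (@pfun2_prod _ _ HL _ _ (gi n) (gi n)).
  rewrite ler_wpM2l// real_normK ?num_real// -expr2 lerDl.
  by rewrite -expr2 sqr_ge0.
rewrite -(pfun2_sum HL)//; apply: (pfun2_le HL).
- exact: lip_sum.
- apply: lipM; first apply: lipM.
  + exact: (lip_fst (lip_cmod vl)).
  + exact: (lip_snd (lip_cmod vl)).
  + exact/lip_cmod/clip_wtransform_div.
move=> x y /=.
have -> : \sum_(n <- s) h n (x, y) = complex.Re ((v x)^*%C * v y *
    wtransform s w (circle_div x y)).
  rewrite mulr_sumr Re_sum; apply: eq_bigr => n _; rewrite mulrCA ReZ.
  congr (_ * _); rewrite /h /= /g.
  have -> : (v x)^*%C * v y * (cval x / cval y) ^ n =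
      (cval x ^ n * (v x)^*%C) * ((cval y ^ n * (v y)^*%C)^*)%C.
    rewrite exprzMl ?unitfE ?invr_eq0 ?circle_neq0//.
    rewrite rmorphM /= conjcK.
    have -> : ((cval y ^ n)^*)%C = (cval y)^-1 ^ n.
      rewrite -circle_conj; case: n => n; first by rewrite -exprnP rmorphXn.
      by rewrite !NegzE -!exprnN rmorphV/= ?rmorphXn// unitfE expf_neq0// circle_neq0.
    by ring.
  move: (cval x ^ n * (v x)^*%C) (cval y ^ n * (v y)^*%C) => X Y.
  by rewrite ReM; case: X => a1 b1; case: Y => a2 b2 /=; ring.
apply: (le_trans (Re_le _)).
by rewrite !cmodM cmod_conj.
Qed.

End LargeSieve.

(* [u_ j] stands for the restriction of [w_ j] to the set A of the theorem. *)
Section EquidistributedWeights.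
Context {R : realType}.
Local Notation T := (circle R).
Variables (s_ : nat -> seq int) (w_ : nat -> int -> R).
Hypothesis w_ge0 : forall j n, 0 <= w_ j n.
Hypothesis w_le1 : forall j, \sum_(n <- s_ j) w_ j n <= 1.
Hypothesis w_equi : forall z : T, cval z != 1 ->
  cmod (wtransform (s_ j) (w_ j) z) @[j --> \oo] --> (0 : R).
Variable u_ : nat -> int -> R.
Hypothesis u_le : forall j n, 0 <= u_ j n <= w_ j n.

Local Notation w j := (wtransform (s_ j) (w_ j)).
Local Notation u j := (wtransform (s_ j) (u_ j)).

Lemma w_transform_le1 j z : cmod (w j z) <= 1.
Proof.
by apply: (le_trans _ (w_le1 j)); apply: wtransform_le => n; rewrite w_ge0 /=.
Qed.

Lemma u_transform_le1 j z : cmod (u j z) <= 1.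
Proof. by apply: (le_trans _ (w_le1 j)); exact: wtransform_le. Qed.

(** The large sieve for counting measure on [S]: the diagonal contributes at most the sum X itself,
    and the off-diagonal terms tend to 0, so they are eventually at most 2. From X^2 <= X + 2
    follows X <= 2. *)
Lemma near_bessel (S : seq T) : uniq S ->
  \forall j \near \oo, \sum_(k <- S) sqmod (u j k) <= 2.
Proof.
move=> uS.
have near_off : \forall j \near \oo, \sum_(k <- S) \sum_(l <- S | l != k)
    cmod (w j (circle_div k l)) <= 2.
  have h : (fun j => \sum_(k <- S) \sum_(l <- S | l != k)
      cmod (w j (circle_div k l))) @ \oo --> (0 : R).
    rewrite [X in _ --> X](_ : 0 = \sum_(k <- S) \sum_(l <- S | l != k) 0 :> R).
      apply: cvg_big => [|k _]; first exact: add_continuous.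
      apply: cvg_big => [|l lk]; first exact: add_continuous.
      by apply: w_equi; apply: circle_ratio_neq1; rewrite eq_sym.
    by rewrite big1// => k _; rewrite big1.
  exact: (cvgr_le _ h).
apply: filterS near_off => j offj.
have := large_sieve (s_ j) (positive_functional_sum S) (u_le j).
rewrite /pfun2 /=; set X := \sum_(k <- S) _ => lsX.
suff XX : X ^+ 2 <= X + 2 by nra.
apply: (le_trans lsX).
apply: (@le_trans _ _ (1 * \sum_(k <- S) \sum_(l <- S)
    cmod (u j k) * cmod (u j l) * cmod (w j (circle_div k l)))).
  rewrite ler_wpM2r ?w_le1//; apply: sumr_ge0 => k _; apply: sumr_ge0 => l _.
  by rewrite !mulr_ge0 ?cmod_ge0.
rewrite mul1r; apply: (le_trans _ (lerD (lexx X) offj)).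
rewrite -big_split /=; rewrite big_seq [leRHS]big_seq.
apply: ler_sum => k kS; rewrite (bigD1_seq k)//= lerD//.
  rewrite -sqr_cmod expr2 -[leRHS]mulr1 ler_wpM2l ?mulr_ge0 ?cmod_ge0//.
  exact: w_transform_le1.
apply: ler_sum => l _; rewrite ler_piMl ?cmod_ge0// -[leRHS]mulr1.
by rewrite ler_pM ?cmod_ge0// u_transform_le1.
Qed.

Variable L : (T -> R) -> R.
Hypothesis HL : positive_functional L.
Hypothesis L1 : L (fun=> 1) <= 1.

Variable i_ : nat -> nat.
Hypothesis i_ge : forall j, (j <= i_ j)%N.

(** The modulus of the transform of [w_ j] at s / t tends at worst to the indicator of the diagonal,
    which is not Lipschitz. The dyadic kernel takes its place, being 1 on the diagonal; the excess
    over it is bounded and tends to 0 everywhere. *)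
Let excess j (p : T * T) : R := Num.max (cmod (w j (circle_div p.1 p.2)) -
  dyadic_kernel (i_ j) (cval p.2 / cval p.1)) 0.

Let lip_excess j : lip cdist2 (excess j).
Proof.
apply: lip_max; last exact: lip_cst.
apply: lipB; last exact: lip_dyadic_kernel2.
exact/lip_cmod/clip_wtransform_div.
Qed.

Let excess_bound j p : 0 <= excess j p <= 1.
Proof.
rewrite le_max lexx orbT ge_max ler01 andbT lerBlDr.
by rewrite (le_trans (w_transform_le1 _ _))// lerDl dyadic_kernel_ge0.
Qed.

Let cvg_excess s t : excess j (s, t) @[j --> \oo] --> (0 : R).
Proof.
have [->|st] := eqVneq s t.
  rewrite (_ : (fun j => _) = fun=> 0); first exact: cvg_cst.
  apply/funext => j; apply/eqP; rewrite eq_le le_max lexx orbT andbT.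
  rewrite ge_max lexx andbT subr_le0 /= divff ?circle_neq0// dyadic_kernel1.
  exact: w_transform_le1.
apply: (@squeeze_cvgr _ _ _ _ (cst 0) (fun j => cmod (w j (circle_div s t)))).
- near=> j; rewrite /= le_max lexx orbT ge_max cmod_ge0 andbT.
  by rewrite gerBl dyadic_kernel_ge0.
- exact: cvg_cst.
- exact/w_equi/circle_ratio_neq1.
Unshelve. all: by end_near. Qed.

Let cvg_pfun2_excess : pfun2 L (excess j) @[j --> \oo] --> (0 : R).
Proof.
apply: (bounded_convergence HL (C := 1)).
- by move=> j; exact: lip_pfun.
- move=> j s; apply/andP; split.
    by apply: (pfun_ge0 HL) => [|t]; [exact: lip_section|case/andP: (excess_bound j (s, t))].
  rewrite (le_trans _ L1)// -[leRHS]mul1r; apply: (pfun_le_cst HL).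
    exact: lip_section.
  by move=> t; case/andP: (excess_bound j (s, t)).
- move=> s; apply: (bounded_convergence HL (C := 1)).
  + by move=> j; exact: lip_section.
  + by move=> j t; exact: excess_bound.
  + exact: cvg_excess.
Qed.

(** The large sieve for the measure with density [residual] with respect to [L]. In 5 * e, one e
    pays for the excess; the rest is 2 * (2 * e), the residual having integral at most 2 and its
    integral against any kernel being at most 2 * e. *)
Lemma near_residual_transform (S : seq T) e : uniq S -> 0 < e ->
  (forall k, k \notin S -> atom L k <= e) ->
  \forall j \near \oo,
    L (fun t => residual S (i_ j) t * sqmod (u j t)) ^+ 2 <= 5 * e.
Proof.
move=> uS e0 tailS.
have i_oo (P : set nat) : (\forall i \near \oo, P i) -> \forall j \near \oo, P (i_ j).
  move=> [N _ NP]; exists N => // j /= Nj; apply: NP => /=.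
  exact: leq_trans Nj (i_ge j).
pose C := (1 + (size S)%:R : R) ^+ 2.
have C0 : 0 < C by rewrite exprn_gt0// ltr_pwDl.
have Cd : 0 < e / C ^+ 2 by rewrite divr_gt0// exprn_gt0.
have n1 := i_oo _ (near_residual_le HL uS ltr01).
have n2 := i_oo _ (near_sup_residual_kernel HL uS tailS e0).
have /cvgrPdist_le/(_ _ Cd) n3 := cvg_pfun2_excess.
apply: filterS3 n1 n2 n3 => j Lq supK.
rewrite sub0r normrN => /(le_trans (ler_norm _)) Lex.
set q := residual S (i_ j).
have q0 t : 0 <= q t := residual_ge0 _ _ _.
have ql : lip cdist q := lip_residual _ _.
have qC t : q t <= C := residual_bound _ _ _.
have HLq := positive_functional_weight HL ql q0.
apply: (le_trans (large_sieve (s_ j) HLq (u_le j))).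
rewrite -[leRHS]mul1r; apply: ler_pM => //; first exact: sumr_ge0.
  apply: (pfun_ge0 HLq) => [|s].
    apply: (lip_pfun HLq (u := fun p => cmod (u j p.1) * cmod (u j p.2) *
      cmod (w j (circle_div p.1 p.2)))).
    apply: lipM; first apply: lipM.
    + exact: (lip_fst (lip_cmod (clip_wtransform _ _))).
    + exact: (lip_snd (lip_cmod (clip_wtransform _ _))).
    + exact/lip_cmod/clip_wtransform_div.
  apply: (pfun_ge0 HLq) => [|t]; last by rewrite !mulr_ge0 ?cmod_ge0.
  apply: (lip_section s (u := fun p => cmod (u j p.1) * cmod (u j p.2) *
      cmod (w j (circle_div p.1 p.2)))).
  apply: lipM; first apply: lipM.
  + exact: (lip_fst (lip_cmod (clip_wtransform _ _))).
  + exact: (lip_snd (lip_cmod (clip_wtransform _ _))).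
  + exact/lip_cmod/clip_wtransform_div.
pose K (p : T * T) := dyadic_kernel (i_ j) (cval p.2 / cval p.1).
have Kl : lip cdist2 K := lip_dyadic_kernel2 _.
have el : lip cdist2 (excess j) by [].
apply: (@le_trans _ _ (pfun2 (fun f => L (fun t => q t * f t))
    (fun p => excess j p + K p))).
  apply: (pfun2_le HLq).
  - apply: lipM; first apply: lipM.
    + exact: (lip_fst (lip_cmod (clip_wtransform _ _))).
    + exact: (lip_snd (lip_cmod (clip_wtransform _ _))).
    + exact/lip_cmod/clip_wtransform_div.
  - exact: lipD.
  move=> s t; apply: (@le_trans _ _ (cmod (w j (circle_div s t)))).
    rewrite ler_piMl ?cmod_ge0// -[leRHS]mulr1.
    by rewrite ler_pM ?cmod_ge0// u_transform_le1.
  by rewrite -lerBlDr /excess le_max lexx.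
rewrite (pfun2D HLq)//.
have -> : 5 * e = C ^+ 2 * (e / C ^+ 2) + 2 * (2 * e).
  by rewrite (mulrC (C ^+ 2)) divfK ?gt_eqF ?exprn_gt0//; ring.
apply: lerD.
  apply: (@le_trans _ _ (C ^+ 2 * pfun2 L (excess j))); last first.
    by rewrite ler_wpM2l// sqr_ge0.
  rewrite -(pfun2Z HL)// /pfun2; apply: (pfun_le HL).
  - by apply: lipM => //; exact: (lip_pfun HLq).
  - by apply: (lip_pfun HL (u := fun p => C ^+ 2 * excess j p)); exact: lipZ.
  move=> s; apply: (@le_trans _ _ (C * L (fun t => C * excess j (s, t)))).
    apply: ler_pM => //.
      apply: (pfun_ge0 HLq) => [|t]; first exact: lip_section.
      by case/andP: (excess_bound j (s, t)).
    apply: (pfun_le HL).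
    - by apply: lipM => //; exact: lip_section.
    - by apply: lipZ; exact: lip_section.
    by move=> t; rewrite ler_wpM2r//; case/andP: (excess_bound j (s, t)).
  rewrite -(pfunZ HL); last by apply: lipZ; exact: lip_section.
  by under eq_fun do rewrite mulrA -expr2.
rewrite /pfun2; apply: (@le_trans _ _ (L (fun s => 2 * e * q s))).
  apply: (pfun_le HL).
  - by apply: lipM => //; exact: (lip_pfun HLq).
  - exact: lipZ.
  by move=> s; rewrite mulrC ler_wpM2r// supK.
rewrite (pfunZ HL)// mulrC ler_wpM2r ?mulr_ge0 ?(ltW e0)//.
by rewrite (le_trans Lq)// -lerBrDr (le_trans L1)//; lra.
Qed.

End EquidistributedWeights.

(** * Fourier analysis of periodic functions *)

Section CircleExponential.
Context {R : realType}.
Implicit Types t : R.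

Lemma expi0 : expi (0 : R) = 1.
Proof. by rewrite /expi cos0 sin0. Qed.

Lemma expiD t1 t2 : expi (t1 + t2) = expi t1 * expi t2.
Proof. by rewrite /expi cosD sinD; congr Complex; rewrite addrC. Qed.

Lemma expi_natl n t : expi (n%:R * t) = expi t ^+ n.
Proof.
elim: n => [|n ih]; first by rewrite mul0r expi0.
by rewrite -natr1 mulrDl mul1r expiD ih exprSr.
Qed.

Lemma cmod_expi t : cmod (expi t) = 1.
Proof. by rewrite /cmod /sqmod /= cos2Dsin2 sqrtr1. Qed.

Lemma expi_neq0 t : expi t != 0.
Proof. by rewrite -cmod_eq0 cmod_expi oner_eq0. Qed.

Lemma expiN t : expi (- t) = (expi t)^-1.
Proof.
by apply: (mulfI (expi_neq0 t)); rewrite -expiD subrr expi0 mulfV ?expi_neq0.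
Qed.

Lemma expi_intl (n : int) t : expi (n%:~R * t) = expi t ^ n.
Proof.
case: n => n; first exact: expi_natl.
by rewrite NegzE rmorphN mulNr expiN (expi_natl n.+1) -exprnN.
Qed.

Definition circle_expi t : circle R := Circle (expi t) (introT eqP (cmod_expi t)).

Lemma expi_neq1 t : 0 < t < 2 * pi -> expi t != 1.
Proof.
move=> /andP[t0 tpi]; apply/eqP => -[] cos1 _.
have : 0 < sin (t / 2).
  by apply: sin_gt0_pi; rewrite divr_gt0//= ltr_pdivrMr// mulrC.
suff -> : sin (t / 2) = 0 by rewrite ltxx.
apply/eqP; rewrite -sqrf_eq0; apply/eqP.
have := cosD (t / 2) (t / 2); rewrite -splitr cos1 -!expr2.
by have := cos2Dsin2 (t / 2); lra.
Qed.

(** Converts points other than 1 into the angles for which equidistribution is stated. *)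
Lemma circle_angle (z : circle R) : cval z != 1 ->
  exists2 t, 0 < t < 2 * pi & cval z = expi t.
Proof.
case: z => -[a b] /= /eqP ab1 ab.
have {}ab1 : a ^+ 2 + b ^+ 2 = 1.
  by have := sqr_cmod (Complex a b); rewrite ab1 expr1n.
have a1 : -1 <= a <= 1.
  have := sqr_ge0 b; have := sqr_ge0 a => ha hb.
  by apply/andP; split; nra.
have [/andP[t0 tpi] cost] := acos_def a1.
have sint : sin (acos a) = `|b|.
  by rewrite sin_acos// -sqrtr_sqr; congr Num.sqrt; lra.
have pi0 : 0 < pi :> R := pi_gt0 R.
have an1 : acos a = 0 -> False.
  move=> a0; move: cost sint; rewrite a0 cos0 sin0 => a1' /esym/normr0P/eqP b0.
  by move/eqP: ab; apply; rewrite b0 -a1'.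
have t_gt0 : 0 < acos a.
  by rewrite lt_def t0 andbT; apply/eqP.
have [b0|b0] := leP 0 b.
  exists (acos a); first by rewrite t_gt0 /=; lra.
  by rewrite /expi cost sint ger0_norm.
exists (2 * pi - acos a); first by apply/andP; split; lra.
rewrite addrC expiD expiN mulr_natl (_ : expi (pi *+ 2) = 1); last first.
  by rewrite /expi cos2pi sin2pi.
rewrite mulr1 -expiN /expi cosN sinN cost sint ltr0_norm//.
by rewrite opprK.
Qed.

End CircleExponential.

Section Fourier.
Context {R : realType}.
Local Notation T := (circle R).
Variables (N : nat) (f : int -> R).
Hypothesis N_gt0 : (0 < N)%N.
Implicit Types (k : T) (u : int -> R) (g : int -> R[i]) (p : T -> R[i]).

Definition unit_root (m : nat) : T := circle_expi (m%:R * (2 * pi / N%:R)).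

Definition dft (m : nat) : R[i] :=
  N%:R^-1 * \sum_(x < N) (f x)%:C * cval (unit_root m) ^+ x.

(** The spectral measure of the periodic function [f], carried by the roots of unity of order [N].
    The factor 1 / N in [dft] makes its mass the mean of f^2. *)
Definition spectral_functional (u : T -> R) : R :=
  \sum_(m < N) sqmod (dft m) * u (unit_root m).

Let z : R[i] := expi (2 * pi / N%:R).

Let unit_rootE m : cval (unit_root m) = z ^+ m.
Proof. exact: expi_natl. Qed.

Let z_prim : N.-primitive_root z.
Proof.
have pi0 : 0 < pi :> R := pi_gt0 R.
rewrite /primitive_root_of_unity N_gt0 /=; apply/forallP => m.
rewrite unity_rootE -expi_natl; apply/eqP.
have [mN|mN] := eqVneq m.+1 N.
  apply/eqP; rewrite mN mulrCA mulfV ?mulr1 ?pnatr_eq0 -?lt0n//.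
  by rewrite /expi mulr_natl cos2pi sin2pi.
apply/negbTE/expi_neq1; rewrite mulr_gt0 ?divr_gt0 ?mulr_gt0 ?ltr0n//=.
rewrite mulrCA gtr_pMr ?mulr_gt0// ltr_pdivrMr ?ltr0n// mul1r ltr_nat.
by rewrite ltn_neqAle mN /=.
Qed.

Let orthogonality (a b : 'I_N) :
  \sum_(x < N) (z ^+ a / z ^+ b) ^+ x = if a == b then N%:R else 0.
Proof.
have z0 : z != 0 := expi_neq0 _.
case: eqVneq => [->|ab].
  rewrite (eq_bigr (fun=> 1)) => [|x _]; last by rewrite divff ?expf_neq0 ?expr1n.
  by rewrite sumr_const card_ord.
have ne : z ^+ a / z ^+ b - 1 != 0.
  rewrite subr_eq0; apply: contra_neq ab => h.
  have /eqP : z ^+ a = z ^+ b by rewrite -[LHS](divfK (expf_neq0 b z0)) h mul1r.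
  rewrite (eq_prim_root_expr z_prim) !modn_small// => /eqP h'.
  exact: val_inj.
apply: (mulfI ne); rewrite mulr0 -subrX1 exprMn exprVn -!exprM.
by rewrite !(mulnC _ N) !exprM (prim_expr_order z_prim) !expr1n invr1 mulr1 subrr.
Qed.

Hypothesis f_per : forall x : int, f (x + N%:Z) = f x.

Let periodic_ext (g h : int -> R[i]) :
  (forall x, g (x + N%:Z) = g x) -> (forall x, h (x + N%:Z) = h x) ->
  (forall x : nat, (x < N)%N -> g x = h x) -> g =1 h.
Proof.
have per (g' : int -> R[i]) : (forall x, g' (x + N%:Z) = g' x) ->
    forall q x : int, g' (q * N%:Z + x) = g' x.
  move=> gp; elim/int_ind => [x|q ih x|q ih x]; first by rewrite mul0r add0r.
    by rewrite intS mulrDl mul1r -addrA addrC gp ih.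
  rewrite -[LHS]gp -[RHS](ih x); congr g'.
  by rewrite intS; ring.
move=> gp hp gh x; rewrite (divz_eq x N%:Z) !per//.
have Npos : 0 < N%:Z by rewrite ltz_nat.
have := ltz_pmod x Npos; have := modz_ge0 x (lt0r_neq0 Npos).
by case: (x %% N%:Z)%Z => // m _; rewrite ltz_nat; exact: gh.
Qed.

(* [g] is the image of [f] under the Fourier multiplier [p]. *)
Definition has_symbol g p := forall x : int,
  g x = \sum_(m < N) dft m * p (unit_root m) * cval (unit_root m) ^ (- x).

Lemma unit_rootN m : cval (unit_root m) ^+ N = 1.
Proof.
by rewrite unit_rootE -exprM mulnC exprM (prim_expr_order z_prim) expr1n.
Qed.

(** Fourier inversion on one period, extended by periodicity. *)
Lemma has_symbol1 : has_symbol (fun x => (f x)%:C) (fun=> 1).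
Proof.
apply: periodic_ext => [x|x|x xN]; first by rewrite f_per.
  apply: eq_bigr => m _; congr (_ * _).
  rewrite opprD expfzDr ?circle_neq0// -exprnN unit_rootN invr1 mulr1 //.
pose X := Ordinal xN.
transitivity (N%:R^-1 * \sum_(y < N) (f y)%:C *
    \sum_(m < N) (z ^+ y / z ^+ X) ^+ m).
  under eq_bigr do rewrite orthogonality.
  rewrite (bigD1 X)//= eqxx big1 ?addr0 => [|y yX]; last first.
    by rewrite (negbTE yX) mulr0.
  by rewrite mulrCA mulVf ?mulr1// pnatr_eq0 -lt0n.
under eq_bigr do rewrite mulr_sumr.
rewrite exchange_big /= mulr_sumr; apply: eq_bigr => m _.
rewrite mulr1 /dft -[RHS]mulrA; congr (_ * _); rewrite mulr_suml.
apply: eq_bigr => y _; rewrite -mulrA; congr (_ * _).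
rewrite unit_rootE -exprnN exprMn exprVn ?expi_natl -?/z -!exprM.
by rewrite (mulnC y) (mulnC x).
Qed.

Lemma has_symbol_shift g p (n : int) : has_symbol g p ->
  has_symbol (fun x => g (x - n)) (fun t => p t * cval t ^ n).
Proof.
move=> gp x; rewrite gp; apply: eq_bigr => m _.
by rewrite opprB expfzDr ?circle_neq0// !mulrA.
Qed.

Lemma has_symbolZ g p c : has_symbol g p ->
  has_symbol (fun x => c * g x) (fun t => c * p t).
Proof.
move=> gp x; rewrite gp mulr_sumr; apply: eq_bigr => m _.
by rewrite mulrCA !mulrA; congr (_ * _); rewrite mulrAC.
Qed.

Lemma has_symbol_sum I (r : seq I) (G : I -> int -> R[i]) (P : I -> T -> R[i]) :
  (forall i, has_symbol (G i) (P i)) ->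
  has_symbol (fun x => \sum_(i <- r) G i x) (fun t => \sum_(i <- r) P i t).
Proof.
move=> GP x; under eq_bigr do rewrite GP.
rewrite exchange_big /=; apply: eq_bigr => m _.
by rewrite mulr_sumr mulr_suml.
Qed.

Lemma has_symbolB g1 p1 g2 p2 : has_symbol g1 p1 -> has_symbol g2 p2 ->
  has_symbol (fun x => g1 x - g2 x) (fun t => p1 t - p2 t).
Proof.
move=> gp1 gp2 x; rewrite gp1 gp2 -sumrB; apply: eq_bigr => m _.
by rewrite mulrBr mulrBl.
Qed.

(** Turns a mean square over a period into an integral against the spectral measure, the only way in
    which [f] enters the limit. *)
Lemma parseval g p : has_symbol g p ->
  \sum_(x < N) sqmod (g x) = N%:R * spectral_functional (fun t => sqmod (p t)).
Proof.
move=> gp; apply: complexI; rewrite rmorphM rmorph_nat /= !rmorph_sum /=.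
pose c m : R[i] := dft m * p (unit_root m).
transitivity (\sum_(m < N) \sum_(n < N) c m * (c n)^*%C *
    \sum_(x < N) (z ^+ n / z ^+ m) ^+ x).
  under [RHS]eq_bigr do under eq_bigr do rewrite mulr_sumr.
  under [RHS]eq_bigr do rewrite exchange_big.
  rewrite [RHS]exchange_big /=; apply: eq_bigr => x _.
  rewrite -mulcJ gp rmorph_sum /= mulr_suml; apply: eq_bigr => m _.
  rewrite mulr_sumr; apply: eq_bigr => n _.
  rewrite -/(c m) -/(c n) rmorphM /= -/(c n) mulrACA; congr (_ * _).
  have -> : ((cval (unit_root n) ^ (- x%:Z))^*)%C = cval (unit_root n) ^+ x.
    rewrite -exprnN -exprVn rmorphXn -circle_conj; congr (_ ^+ _).
    exact: conjcK.
  rewrite -exprnN -exprVn -exprMn_comm; last exact: mulrC.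
  by rewrite mulrC -!unit_rootE.
rewrite mulr_sumr; apply: eq_bigr => m _.
under eq_bigr do rewrite orthogonality.
rewrite (bigD1 m)//= eqxx big1 ?addr0 => [|n nm]; last first.
  by rewrite (negbTE nm) mulr0.
by rewrite mulcJ mulrC /c sqmodM.
Qed.

End Fourier.

Section LocalMean.
Context {R : realType}.
Local Notation T := (circle R).
Implicit Types (k : T) (f : int -> R).

(* Up to O(2^-i) the average [local_mean i k f] is an eigenfunction of the
   shift, with eigenvalue [k^-1]. *)
Definition local_mean i k f (x : int) : R[i] :=
  (2 ^+ i)^-1 * \sum_(h < 2 ^ i) (cval k)^-1 ^+ h * (f (x - h%:Z))%:C.

Lemma has_symbol_local_mean N f i k : (0 < N)%N ->
  (forall x : int, f (x + N%:Z) = f x) ->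
  has_symbol N f (local_mean i k f) (fun t => dyadic_mean i (cval t / cval k)).
Proof.
move=> N0 fN; apply: has_symbolZ.
have h (n : 'I_(2 ^ i)) := has_symbolZ ((cval k)^-1 ^+ n)
  (has_symbol_shift n (has_symbol1 N0 fN)).
have := has_symbol_sum (index_enum _) h.
congr has_symbol; apply/funext => t; apply: eq_bigr => n _.
by rewrite mul1r exprMn mulrC.
Qed.

(** After multiplication by [k], the sums at x - 1 and at x share all terms but one at each end, and
    each of these has modulus at most 1. *)
Lemma local_mean_shift f i k x : (forall y, 0 <= f y <= 1) ->
  cmod (local_mean i k f (x - 1) - cval k * local_mean i k f x) <= 2 / 2 ^+ i.
Proof.
move=> f01.
have fle y : cmod (f y)%:C <= 1.
  by rewrite cmod_real; case/andP: (f01 y) => f0 ?; rewrite ger0_norm.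
pose S := \sum_(h < (2 ^ i).+1) (cval k)^-1 ^+ h * (f (x - h%:Z))%:C.
have e1 : \sum_(h < 2 ^ i) (cval k)^-1 ^+ h * (f (x - h%:Z))%:C =
    S - (cval k)^-1 ^+ (2 ^ i) * (f (x - (2 ^ i)%N%:Z))%:C.
  by rewrite /S big_ord_recr /= addrK.
have e2 : \sum_(h < 2 ^ i) (cval k)^-1 ^+ h * (f (x - 1 - h%:Z))%:C =
    cval k * (S - (f x)%:C).
  rewrite /S big_ord_recl /= subr0 expr0 mul1r [X in cval k * X]addrC addKr mulr_sumr.
  apply: eq_bigr => h _; rewrite exprS !mulrA mulfV ?circle_neq0// mul1r.
  by rewrite /bump /= add1n intS opprD addrA.
rewrite /local_mean e1 e2 mulrCA -mulrBr -mulrBr cmodM circle_cmod mul1r cmodM.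
have -> : cmod ((2 ^+ i)^-1 : R[i]) = (2 ^+ i)^-1.
  rewrite cmodV cmodX -[2 in LHS](rmorph_nat (real_complex R) 2).
  by rewrite cmod_real ger0_norm.
rewrite mulrC ler_wpM2r ?invr_ge0 ?exprn_ge0//.
rewrite opprB addrC addrA subrK (le_trans (cmodD _ _))//.
rewrite cmodN cmodM cmodX cmodV circle_cmod invr1 expr1n mul1r.
by rewrite lerD.
Qed.

Lemma local_mean_shift_nat f i k x (n : nat) : (forall y, 0 <= f y <= 1) ->
  cmod (local_mean i k f (x - n%:Z) - cval k ^+ n * local_mean i k f x) <=
  n%:R * (2 / 2 ^+ i).
Proof.
move=> f01; elim: n => [|n ih].
  by rewrite subr0 expr0 mul1r subrr cmod0 mul0r.
set F := local_mean i k f in ih *.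
have -> : F (x - n.+1%:Z) - cval k ^+ n.+1 * F x =
    (F (x - n%:Z - 1) - cval k * F (x - n%:Z)) +
    cval k * (F (x - n%:Z) - cval k ^+ n * F x).
  by rewrite intS opprD addrCA addrC exprS; ring.
rewrite (le_trans (cmodD _ _))// -natr1 mulrDl mul1r addrC lerD//.
  by rewrite cmodM circle_cmod mul1r.
exact: local_mean_shift.
Qed.

Lemma local_mean_shift_int f i k x (n : int) : (forall y, 0 <= f y <= 1) ->
  cmod (local_mean i k f (x - n) - cval k ^ n * local_mean i k f x) <=
  (absz n)%:R * (2 / 2 ^+ i).
Proof.
move=> f01; case: n => n; first exact: local_mean_shift_nat.
rewrite NegzE opprK abszN absz_nat.
have := local_mean_shift_nat i k (x + n.+1%:Z) n.+1 f01.
rewrite addrK -exprnN -[cmod (_ - _)]mul1r.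
set F := local_mean i k f.
have -> : 1 = cmod ((cval k) ^- n.+1) :> R.
  by rewrite cmodV cmodX circle_cmod expr1n invr1.
rewrite -cmodM mulrBr mulKf ?expf_neq0 ?circle_neq0//.
by rewrite cmodB.
Qed.

Lemma local_mean_le1 f i k x : (forall y, 0 <= f y <= 1) ->
  cmod (local_mean i k f x) <= 1.
Proof.
move=> f01; rewrite /local_mean cmodM.
have -> : cmod ((2 ^+ i)^-1 : R[i]) = (2 ^+ i)^-1.
  rewrite cmodV cmodX -[2 in LHS](rmorph_nat (real_complex R) 2).
  by rewrite cmod_real ger0_norm.
rewrite mulrC ler_pdivrMr ?exprn_gt0// mul1r (le_trans (cmod_sum _ _ _))//.
rewrite -natrX -[leRHS](_ : \sum_(h < 2 ^ i) 1 = _); last first.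
  by rewrite sumr_const card_ord.
apply: ler_sum => h _; rewrite cmodM cmodX cmodV circle_cmod invr1 expr1n mul1r.
by rewrite cmod_real; case/andP: (f01 (x - h%:Z)) => ? ?; rewrite ger0_norm.
Qed.

Lemma local_mean1 f i x : local_mean i circle1 f x =
  ((2 ^+ i)^-1 * \sum_(h < 2 ^ i) f (x - h%:Z))%:C.
Proof.
rewrite /local_mean rmorphM /= fmorphV rmorphXn rmorph_nat rmorph_sum /=.
by congr (_ * _); apply: eq_bigr => h _; rewrite invr1 expr1n mul1r.
Qed.

End LocalMean.

(** * Lower bound for the convolution *)

Section PeriodicSums.
Context {R : realType}.
Implicit Types g : int -> R.

Lemma sum_periodic_shift g (N : nat) (l : nat) :
  (forall x : int, g (x + N%:Z) = g x) ->
  \sum_(x < N) g (x%:Z + l%:Z) = \sum_(x < N) g x.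
Proof.
move=> gN; elim: l => [|l ih].
  by apply: eq_bigr => x _; rewrite addr0.
rewrite -ih; case: N gN {ih} => [|N] gN; first by rewrite !big_ord0.
rewrite big_ord_recr [RHS]big_ord_recl /= addrC; congr (_ + _).
  by rewrite -[in RHS]gN; congr g; lia.
by apply: eq_bigr => x _; congr g; rewrite /bump /=; lia.
Qed.

Lemma sum_ltn_le (N M : nat) : \sum_(x < N) (x < M)%:R <= M%:R :> R.
Proof.
suff : (\sum_(x < N) (x < M) <= minn N M)%N.
  rewrite -natr_sum ler_nat => h; apply: (leq_trans h); exact: geq_minr.
elim: N => [|N ih]; first by rewrite big_ord0.
rewrite big_ord_recr /=; move: ih; set X := bigop _ _.
by case: (ltnP N M) => /=; lia.
Qed.

Lemma sum_gtn_le (N M : nat) : \sum_(x < N) (N < x + M)%:R <= M%:R :> R.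
Proof.
suff h n : (\sum_(x < n) (N < x + M) <= n + M - N.+1)%N.
  by rewrite -natr_sum ler_nat; apply: (leq_trans (h N)); lia.
elim: n => [|n ih]; first by rewrite big_ord0.
rewrite big_ord_recr /=; move: ih; set X := bigop _ _.
by case: (ltnP N (n + M)) => /=; lia.
Qed.

(* Markov's inequality for [t] and for the [W] translates of [e]. *)
Lemma exists_good_point (N B W : nat) (F e t : int -> R) (delta tau eta : R) :
  0 < delta -> 0 < tau -> 0 < eta ->
  (forall x, F x <= 1) -> (forall x, 0 <= e x) -> (forall x, 0 <= t x) ->
  (forall x : int, e (x + N%:Z) = e x) ->
  delta * N%:R <= \sum_(x < N) F x ->
  \sum_(x < N) t x <= N%:R * (tau * delta / 8) ->
  \sum_(x < N) e x <= N%:R * (eta * delta / (8 * W.+1%:R)) ->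
  (2 * B + W)%:R < delta / 8 * N%:R ->
  exists x : nat, [/\ (B <= x)%N, (x + W + B <= N)%N, delta / 4 <= F x,
    t x <= tau & forall l, (l < W)%N -> e (x%:Z + l%:Z) <= eta].
Proof.
move=> d0 tau0 eta0 F1 e0 t0 eN Fsum tsum esum Nlarge.
apply: contrapT => /forallNP nx.
(* At a point that is not good, either F x < delta / 4 or one of the other terms is at least 1.
   Summing over the period, the right-hand side is below 5/8 of delta * N. *)
have bound (x : nat) : F x <= delta / 4 + t x / tau +
    (\sum_(l < W) e (x%:Z + l%:Z)) / eta + ((x < B)%N%:R + (N < x + (W + B))%N%:R).
  have te : 0 <= t x / tau by rewrite divr_ge0// ltW.
  have ee : 0 <= (\sum_(l < W) e (x%:Z + l%:Z)) / eta.
    by rewrite divr_ge0 ?sumr_ge0// ltW.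
  have Fx := F1 x.
  have [xB|Bx] := ltnP x B.
    by have := ler0n R (N < x + (W + B)); rewrite /=; lra.
  have [Nx|xN] := ltnP N (x + (W + B)); first by rewrite /=; lra.
  rewrite /= !addr0; rewrite leNgt; apply/negP => lt.
  apply: (nx x); split=> //; first by rewrite -addnA.
  - by lra.
  - by rewrite -[leRHS]mul1r -ler_pdivrMr//; lra.
  move=> l lW; apply: (@le_trans _ _ (\sum_(l < W) e (x%:Z + l%:Z))).
    by rewrite (bigD1 (Ordinal lW))//= lerDl sumr_ge0.
  by rewrite -[leRHS]mul1r -ler_pdivrMr//; lra.
have : delta * N%:R <= \sum_(x < N) (delta / 4 + t x / tau +
    (\sum_(l < W) e (x%:Z + l%:Z)) / eta +
    ((x < B)%N%:R + (N < x + (W + B))%N%:R)).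
  by apply: (le_trans Fsum); apply: ler_sum => x _; exact: bound.
rewrite !big_split /= sumr_const card_ord -!mulr_suml.
have -> : \sum_(x < N) \sum_(l < W) e (x%:Z + l%:Z) =
    (\sum_(x < N) e x) * W%:R.
  rewrite exchange_big /= (eq_bigr (fun=> \sum_(x < N) e x)).
    by rewrite sumr_const card_ord mulr_natr.
  by move=> l _; exact: sum_periodic_shift.
rewrite -[_ *+ N]mulr_natr.
have h1 : (\sum_(x < N) t x) / tau <= delta / 8 * N%:R.
  rewrite ler_pdivrMr// (le_trans tsum)// le_eqVlt; apply/orP; left.
  by apply/eqP; field.
have h2 : (\sum_(x < N) e x) * W%:R / eta <= delta / 8 * N%:R.
  rewrite ler_pdivrMr//.
  apply: (@le_trans _ _ ((\sum_(x < N) e x) * W.+1%:R)).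
    by rewrite ler_wpM2l ?sumr_ge0// ler_nat.
  rewrite -ler_pdivlMr ?ltr0n// (le_trans esum)// le_eqVlt; apply/orP; left.
  have : W.+1%:R != 0 :> R by rewrite pnatr_eq0.
  by move: W.+1%:R => w w0; apply/eqP; field.
have h3 := sum_ltn_le N B; have h4 := sum_gtn_le N (W + B).
have h5 : (2 * B + W)%:R = B%:R + (W + B)%:R :> R by rewrite -natrD mul2n -addnn -addnA (addnC B W).
have N0 : 0 <= N%:R :> R by [].
have dN : 0 <= delta * N%:R by rewrite mulr_ge0// ltW.
by move: Nlarge; rewrite h5; move: h1 h2 h3 h4 dN; lra.
Qed.

End PeriodicSums.

Section PointwiseBound.
Context {R : realType}.
Local Notation T := (circle R).

(** Three errors: [eta] for the part of [f] not captured by the frequencies in S ++ S2; 3/2 * theta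
    for those in [S2], as theta / 2 * 2 + theta^2 / (2 * theta); and the cost [D k] of replacing
    each [F k] at y - n by its value at [x] times k^(n - l), a shift of at most B + W steps. *)
Lemma convolution_lower_bound (S S2 : seq T) (i : nat) (s : seq int)
    (u f : int -> R) (B W : nat) (x : int) (l : nat) (theta eta : R) :
  (forall y, 0 <= f y <= 1) -> (forall n, 0 <= u n) ->
  \sum_(n <- s) u n <= 1 -> {in s, forall n, (absz n <= B)%N} ->
  (l <= W)%N -> 0 < theta -> 0 <= eta ->
  \sum_(k <- S2) sqmod (wtransform s u k) <= 2 ->
  \sum_(k <- S2) sqmod (local_mean i k f x) <= theta ^+ 2 ->
  sqmod (\sum_(n <- s) (u n)%:C * ((f (x + l%:Z - n))%:C -
    \sum_(k <- S ++ S2) local_mean i k f (x + l%:Z - n))) <= eta ^+ 2 ->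
  complex.Re (\sum_(k <- S) wtransform s u k * local_mean i k f x *
    cval k ^- l) -
    (eta + 3 / 2 * theta + (size (S ++ S2) * (B + W))%:R * (2 / 2 ^+ i)) <=
  \sum_(n <- s) u n * f (x + l%:Z - n).
Proof.
move=> f01 u0 u1 sB lW th0 eta0 aS2 FS2 eS.
pose F k := local_mean i k f; pose y := x + l%:Z.
pose a k := wtransform s u k.
pose M k := a k * F k x * cval k ^- l.
pose D k := \sum_(n <- s) (u n)%:C * F k (y - n) - M k.
have cD k : cmod (D k) <= (B + W)%:R * (2 / 2 ^+ i).
  rewrite /D /M /a /wtransform !mulr_suml -sumrB (le_trans (cmod_sum _ _ _))//.
  apply: (@le_trans _ _ (\sum_(n <- s) u n * ((B + W)%:R * (2 / 2 ^+ i)))).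
    rewrite big_seq [leRHS]big_seq; apply: ler_sum => n ns.
    have -> : (u n)%:C * F k (y - n) - (u n)%:C * cval k ^ n * F k x * cval k ^- l =
        (u n)%:C * (F k (x - (n - l%:Z)) - cval k ^ (n - l%:Z) * F k x).
      rewrite expfzDr ?circle_neq0// -exprnN mulrBr; congr (_ - _); last by ring.
      by congr (_ * F k _); rewrite /y opprB addrA.
    rewrite cmodM cmod_real ger0_norm// ler_wpM2l//.
    apply: (le_trans (local_mean_shift_int i k x (n - l%:Z) f01)).
    rewrite ler_wpM2r ?divr_ge0// ler_nat.
    by have := sB n ns; lia.
  by rewrite -mulr_suml -[leRHS]mul1r ler_wpM2r// mulr_ge0// divr_ge0.
pose Ur := \sum_(n <- s) (u n)%:C * ((f (y - n))%:C -
    \sum_(k <- S ++ S2) F k (y - n)).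
have dec : (\sum_(n <- s) u n * f (y - n))%:C =
    Ur + (\sum_(k <- S) M k + \sum_(k <- S2) M k) + \sum_(k <- S ++ S2) D k.
  rewrite -addrA -big_cat -big_split /=.
  under [X in _ = _ + X]eq_bigr do rewrite /D addrC subrK.
  rewrite exchange_big -big_split rmorph_sum /=; apply: eq_bigr => n _.
  have -> : \sum_(k <- S ++ S2) (u n)%:C * F k (y - n) =
      (u n)%:C * \sum_(k <- S ++ S2) F k (y - n) by rewrite mulr_sumr.
  by rewrite -mulrDr subrK rmorphM.
have := congr1 (@complex.Re R) dec; rewrite !ReD /= => ->.
have hU : - eta <= complex.Re Ur.
  apply: (le_trans _ (Re_leN _)); rewrite lerN2.
  by rewrite -ler_sqr ?nnegrE ?cmod_ge0// sqr_cmod.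
have hD : - ((size (S ++ S2) * (B + W))%:R * (2 / 2 ^+ i)) <=
    complex.Re (\sum_(k <- S ++ S2) D k).
  apply: (le_trans _ (Re_leN _)); rewrite lerN2 (le_trans (cmod_sum _ _ _))//.
  apply: (@le_trans _ _ (\sum_(k <- S ++ S2) (B + W)%:R * (2 / 2 ^+ i))).
    by apply: ler_sum => k _; exact: cD.
  by rewrite big_const_seq count_predT iter_addr_0 natrM -mulrA -[leLHS]mulr_natl.
have h2 : - (3 / 2 * theta) <= complex.Re (\sum_(k <- S2) M k).
  apply: (le_trans _ (Re_leN _)); rewrite lerN2 (le_trans (cmod_sum _ _ _))//.
  (* AM-GM: [|a F| <= (theta |a|^2 + |F|^2 / theta) / 2] *)
  apply: (@le_trans _ _ (\sum_(k <- S2)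
      (theta / 2 * sqmod (a k) + (2 * theta)^-1 * sqmod (F k x)))).
    apply: ler_sum => k _; have -> : cmod (M k) = cmod (a k) * cmod (F k x).
      by rewrite cmodM cmodV cmodX circle_cmod expr1n invr1 mulr1 cmodM.
    rewrite -!sqr_cmod -subr_ge0.
    have -> : theta / 2 * cmod (a k) ^+ 2 + (2 * theta)^-1 * cmod (F k x) ^+ 2 -
        cmod (a k) * cmod (F k x) =
        (2 * theta)^-1 * (theta * cmod (a k) - cmod (F k x)) ^+ 2.
      by field; rewrite gt_eqF.
    by rewrite mulr_ge0 ?sqr_ge0// invr_ge0 mulr_ge0// ltW.
  rewrite big_split /= -!mulr_sumr.
  have i1 : theta / 2 * \sum_(k <- S2) sqmod (a k) <= theta.
    rewrite -[leRHS](divfK (_ : 2 != 0)) ?pnatr_eq0// ler_wpM2l//.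
    by rewrite divr_ge0// ltW.
  have i2 : (2 * theta)^-1 * \sum_(k <- S2) sqmod (F k x) <= theta / 2.
    have -> : theta / 2 = (2 * theta)^-1 * theta ^+ 2 by field; rewrite gt_eqF.
    by rewrite ler_wpM2l// invr_ge0 mulr_ge0// ltW.
  by have := lerD i1 i2; lra.
by rewrite -/(M _); move: hU hD h2; lra.
Qed.

End PointwiseBound.

(** * The limit of the spectral measures *)

Section SpectralLimit.
Context {R : realType}.
Local Notation T := (circle R).
Variables (N_ : nat -> nat) (f_ : nat -> int -> R).
Hypothesis N_gt0 : forall k, (0 < N_ k)%N.
Hypothesis f_per : forall k (x : int), f_ k (x + (N_ k)%:Z) = f_ k x.
Hypothesis f_01 : forall k x, 0 <= f_ k x <= 1.

Let spec k := spectral_functional (N_ k) (f_ k).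

Lemma spectral_mass k : spec k (fun=> 1) <= 1.
Proof.
have := parseval (N_gt0 k) (has_symbol1 (N_gt0 k) (f_per k)).
rewrite (_ : (fun t : T => sqmod 1) = fun=> 1); last first.
  by apply/funext => t; rewrite -sqr_cmod cmod1 expr1n.
have N0 : 0 < (N_ k)%:R :> R by rewrite ltr0n.
move=> h; rewrite -(ler_pM2l N0) /spec -h mulr1.
rewrite -[leRHS](_ : \sum_(x < N_ k) 1 = _); last by rewrite sumr_const card_ord.
apply: ler_sum => x _; rewrite -sqr_cmod cmod_real real_normK ?num_real//.
by have /andP[f0 f1] := f_01 k x; rewrite expr_le1.
Qed.

Lemma spectral_bound k (u : T -> R) C : (forall t, `|u t| <= C) ->
  `|spec k u| <= C.
Proof.
move=> uC; have C0 : 0 <= C by apply: le_trans (uC circle1).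
apply: (@le_trans _ _ (C * spec k (fun=> 1))); last first.
  by rewrite -[leRHS]mulr1 ler_wpM2l// spectral_mass.
rewrite /spec /spectral_functional mulr_sumr (le_trans (ler_norm_sum _ _ _))//.
apply: ler_sum => m _; rewrite normrM ger0_norm ?sqmod_ge0// mulr1 mulrC.
by rewrite ler_wpM2r ?sqmod_ge0.
Qed.

(** The ultralimit treats all test functions at once, with no diagonal extraction of a
    subsequence. *)
Definition spectral_limit (u : T -> R) : R := ulim (fun k => spec k u).

Lemma spectral_limit_positive : positive_functional spectral_limit.
Proof.
split=> [u v [_ [C C0 uC]] [_ [D D0 vD]]|c u [_ [C C0 uC]]|u [_ [C C0 uC]] u0].
- rewrite /spectral_limit -(@ulimD _ _ _ C D) => [|k|k]; last 2 first.
    exact: spectral_bound.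
    exact: spectral_bound.
  congr ulim; apply/funext => k; rewrite /spec /spectral_functional -big_split.
  by apply: eq_bigr => m _ /=; rewrite mulrDr.
- rewrite /spectral_limit -(@ulimZ _ _ _ C) => [|k]; last exact: spectral_bound.
  congr ulim; apply/funext => k; rewrite /spec /spectral_functional mulr_sumr.
  by apply: eq_bigr => m _; rewrite mulrCA.
- apply: (@ulim_ge0 _ _ C) => k; apply/andP; split.
    by apply: sumr_ge0 => m _; rewrite mulr_ge0 ?sqmod_ge0.
  exact: le_trans (ler_norm _) (spectral_bound k uC).
Qed.

Lemma spectral_limit1 : spectral_limit (fun=> 1) <= 1.
Proof.
have b k : `|spec k (fun=> 1)| <= 1 by apply: spectral_bound => t; rewrite normr1.
have h := ulim_cvg b.
by apply: (cvgr_to_le h); apply: nearW => k; exact: spectral_mass.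
Qed.

(** Carries upper bounds from the limit back to a single [f_ k]; finitely many of them hold together
    for some [k]. *)
Lemma near_spectral_limit (u : T -> R) c : lip cdist u ->
  spectral_limit u < c -> \forall k \near nat_ultra, spec k u < c.
Proof.
move=> [_ [C C0 uC]] uc.
have d0 : 0 < c - spectral_limit u by rewrite subr_gt0.
have := near_ulim (fun k => spectral_bound k uC) d0.
by apply: filterS => k /(le_lt_trans (ler_norm _)); rewrite ltrD2r.
Qed.

End SpectralLimit.

Section MainEstimate.
Context {R : realType}.
Local Notation T := (circle R).
Variables (s_ : nat -> seq int) (w_ : nat -> int -> R) (B_ : nat -> nat).
Hypothesis s_bound : forall j, {in s_ j, forall n, (absz n <= B_ j)%N}.
Hypothesis w_ge0 : forall j n, 0 <= w_ j n.
Hypothesis w_le1 : forall j, \sum_(n <- s_ j) w_ j n <= 1.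
Hypothesis w_equi : forall z : T, cval z != 1 ->
  cmod (wtransform (s_ j) (w_ j) z) @[j --> \oo] --> (0 : R).
Variables (u_ : nat -> int -> R) (alpha : R).
Hypothesis u_le : forall j n, 0 <= u_ j n <= w_ j n.
Hypothesis alpha_gt0 : 0 < alpha.
Hypothesis u_ge : forall j, alpha <= \sum_(n <- s_ j) u_ j n.

Variables (N_ : nat -> nat) (f_ : nat -> int -> R) (delta : R).
Hypothesis N_gt : forall k, (k < N_ k)%N.
Hypothesis f_per : forall k (x : int), f_ k (x + (N_ k)%:Z) = f_ k x.
Hypothesis f_01 : forall k x, 0 <= f_ k x <= 1.
Hypothesis delta_gt0 : 0 < delta.
Hypothesis f_dense : forall k, delta * (N_ k)%:R <= \sum_(x < N_ k) f_ k x.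

Local Notation u j := (wtransform (s_ j) (u_ j)).

(* Only finitely many frequencies, independent of the length [W] of the window,
   occur in the lower bound. Taking the mean-square error small compared to [1 / W]
   requires a larger set [S ++ S2], but the contribution of [S2] is controlled at
   every point of the window by Bessel's inequality for the transforms of [u_ j]
   and by the small total mass of the atoms outside of [S]. *)
Lemma structured_convolution : exists2 S : seq T, uniq S /\ circle1 \in S &
  forall W J : nat, exists j k x : nat, exists p : T -> R[i],
    [/\ (J <= j)%N, (B_ j <= x)%N, (x + W + B_ j <= N_ k)%N,
      (forall t, cmod (p t) <= cmod (u j t)) /\
      alpha * delta / 4 <= complex.Re (p circle1) &
      forall l, (l < W)%N ->
        complex.Re (\sum_(t <- S) p t * cval t ^- l) - alpha * delta / 16 <=
        \sum_(n <- s_ j) u_ j n * f_ k (x%:Z + l%:Z - n)].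
Proof.
have N_gt0 k : (0 < N_ k)%N by exact: leq_ltn_trans (N_gt k).
have u_ge0 j n : 0 <= u_ j n by case/andP: (u_le j n).
have u_le1 j : \sum_(n <- s_ j) u_ j n <= 1.
  by apply: (le_trans _ (w_le1 j)); apply: ler_sum => n _; case/andP: (u_le j n).
pose L := spectral_limit N_ f_.
have HL : positive_functional L by exact: spectral_limit_positive.
have L1 : L (fun=> 1) <= 1 by exact: spectral_limit1.
(* The total error will be theta + 3/2 * theta + theta, below 4 * theta = alpha * delta / 16. *)
pose theta := alpha * delta / 64.
have th0 : 0 < theta by rewrite divr_gt0// mulr_gt0.
(* [exists_good_point] allows theta^2 * delta / 8 = 3 * e0 for [S2]: its atoms have mass at most
   [e0], its kernels of order [i_ j] at most 2 * e0 in the limit functional, and less than 3 * e0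
   for a suitable [f_ k]. *)
pose e0 := theta ^+ 2 * delta / 24.
have e0_gt0 : 0 < e0 by rewrite divr_gt0// mulr_gt0// exprn_gt0.
have [S0 uS0 tail0] := atom_tail HL e0_gt0.
pose S := undup (circle1 :: S0).
have uS : uniq S := undup_uniq _.
have S0S t : t \in S0 -> t \in S by rewrite mem_undup inE => ->; rewrite orbT.
exists S; first by rewrite uS mem_undup mem_head.
move=> W J.
(* [E] is the mean square for which [exists_good_point] gives an error of modulus at most [theta] on
   the whole window. With [e1], the bound 5 * e1 of [near_residual_transform] is a quarter of
   E^2. *)
pose E := theta ^+ 2 * delta / (8 * W.+1%:R).
have E_gt0 : 0 < E by rewrite divr_gt0 ?mulr_gt0 ?exprn_gt0 ?ltr0n.
pose e1 := E ^+ 2 / 20.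
have e1_gt0 : 0 < e1 by rewrite divr_gt0// exprn_gt0.
have [S1 uS1 tail1] := atom_tail HL e1_gt0.
pose S2 := [seq t <- S1 | t \notin S].
have uS2 : uniq S2 by rewrite filter_uniq.
have uS' : uniq (S ++ S2).
  rewrite cat_uniq uS uS2 andbT /=; apply/hasPn => t.
  by rewrite mem_filter => /andP[].
have tailS' t : t \notin S ++ S2 -> atom L t <= e1.
  rewrite mem_cat mem_filter negb_or negb_and negbK => /andP[tS].
  rewrite (negbTE tS) /= => tS1; have := tail1 [:: t] isT.
  by rewrite big_seq1; apply => t'; rewrite inE => /eqP ->.
(* The averages are exponentially long compared with the support bound [B_ j], so the local means
   remain almost eigenfunctions over the whole support of [u_ j]. *)
pose i_ j := (B_ j + j)%N.
have i_ge j : (j <= i_ j)%N by rewrite leq_addl.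
have near1 : \forall j \near \oo,
    L (fun t => residual (S ++ S2) (i_ j) t * sqmod (u j t)) ^+ 2 <= 5 * e1.
  exact: (near_residual_transform w_ge0 w_le1 w_equi u_le HL L1 i_ge).
have near2 : \forall j \near \oo, \sum_(t <- S2) sqmod (u j t) <= 2.
  exact: (near_bessel w_ge0 w_le1 w_equi u_le).
have near3 : \forall j \near \oo,
    \sum_(t <- S2) kernel_mass L (i_ j) t <= 2 * e0.
  have lt : \sum_(t <- S2) atom L t < 2 * e0.
    have : \sum_(t <- S2) atom L t <= e0.
      apply: tail0 => // t; rewrite mem_filter => /andP[tS _].
      by apply: contra tS; exact: S0S.
    by lra.
  have h := @cvg_sum_kernel_mass _ _ HL S2.
  have [M _ MP] := cvgr_le _ h _ lt.
  by exists M => // j /= Mj; apply: MP; exact: leq_trans (i_ge j).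
have near4 : \forall j \near \oo,
    (size (S ++ S2) * (B_ j + W))%:R * (2 / 2 ^+ i_ j) <= theta.
  (* As B + W <= (W + 1)(B + 1) and 2^(B + j) >= (B + 1)(j + 1), the error is at most C / (j + 1),
     however fast [B_ j] grows. *)
  pose C := (size (S ++ S2) * W.+1 * 2)%N.
  exists (Num.truncn (C%:R / theta)) => // j /= jC.
  have Cj : C%:R <= theta * j.+1%:R.
    rewrite mulrC -ler_pdivrMr// (le_trans (ltW (truncnS_gt _)))// ler_nat.
    by rewrite ltnS.
  have pow : ((B_ j).+1 * j.+1 <= 2 ^ i_ j)%N.
    by rewrite /i_ expnD leq_mul// ltn_expl.
  rewrite mulrA ler_pdivrMr ?exprn_gt0// -natrX.
  apply: (@le_trans _ _ (theta * ((B_ j).+1 * j.+1)%:R)); last first.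
    by rewrite ler_wpM2l ?ler_nat// ltW.
  have -> : theta * ((B_ j).+1 * j.+1)%:R = theta * j.+1%:R * (B_ j).+1%:R.
    by rewrite natrM; ring.
  apply: (@le_trans _ _ (C%:R * (B_ j).+1%:R)); last by rewrite ler_wpM2r.
  have h : (B_ j + W <= W.+1 * (B_ j).+1)%N.
    by rewrite mulSn mulnS addSn addnA leqW ?leq_addr.
  rewrite -!natrM ler_nat /C -!mulnA leq_mul2l; apply/orP; right.
  by rewrite (mulnC 2) mulnA leq_mul2r.
have [j [Jj [j1 [j2 [j3 j4]]]]] : exists j, (J <= j)%N /\
    L (fun t => residual (S ++ S2) (i_ j) t * sqmod (u j t)) ^+ 2 <= 5 * e1 /\
    \sum_(t <- S2) sqmod (u j t) <= 2 /\
    \sum_(t <- S2) kernel_mass L (i_ j) t <= 2 * e0 /\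
    (size (S ++ S2) * (B_ j + W))%:R * (2 / 2 ^+ i_ j) <= theta.
  have nJ : \forall j \near \oo, (J <= j)%N by exists J.
  apply: (@filter_ex _ \oo _ _
    (filterI nJ (filterI near1 (filterI near2 (filterI near3 near4))))).
pose i := i_ j.
have resl : lip cdist (fun t => residual (S ++ S2) i t * sqmod (u j t)).
  by apply: lipM; [exact: lip_residual|exact/lip_sqmod/clip_wtransform].
have Lres : L (fun t => residual (S ++ S2) i t * sqmod (u j t)) < E.
  rewrite -(@ltr_sqr _ _ E) ?nnegrE ?(ltW E_gt0)//; last first.
    by apply: (pfun_ge0 HL) => // t; rewrite mulr_ge0 ?sqmod_ge0.
  apply: (le_lt_trans j1); rewrite /e1.
  by have : 0 < E ^+ 2 by [rewrite exprn_gt0]; lra.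
have kerl t : lip cdist (fun z => dyadic_kernel i (cval z / cval t)).
  exact: lip_dyadic_kernel.
have Lker : L (fun z => \sum_(t <- S2) dyadic_kernel i (cval z / cval t)) < 3 * e0.
  by rewrite (pfun_sum HL)//; move: j3; rewrite /kernel_mass -/i; lra.
(* With [j] fixed, both test functions are fixed as well, and the period can be taken long compared
   with [B_ j] and [W]. *)
have [k [k1 [k2 k3]]] : exists k,
    spectral_functional (N_ k) (f_ k)
      (fun t => residual (S ++ S2) i t * sqmod (u j t)) < E /\
    spectral_functional (N_ k) (f_ k)
      (fun z => \sum_(t <- S2) dyadic_kernel i (cval z / cval t)) < 3 * e0 /\
    (2 * B_ j + W)%:R < delta / 8 * (N_ k)%:R.
  pose K := Num.truncn (8 / delta * (2 * B_ j + W)%:R).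
  have nK : \forall k \near nat_ultra, (2 * B_ j + W)%:R < delta / 8 * (N_ k)%:R.
    apply: filterS (nat_ultra_ge K) => k Kk.
    have : 8 / delta * (2 * B_ j + W)%:R < (N_ k)%:R.
      apply: (lt_le_trans (truncnS_gt _)).
      by rewrite ler_nat; exact: leq_ltn_trans Kk (N_gt k).
    rewrite -(ltr_pM2l (_ : 0 < delta / 8)) ?divr_gt0//; apply: le_lt_trans.
    by rewrite mulrA (_ : delta / 8 * (8 / delta) = 1) ?mul1r//; field; rewrite gt_eqF.
  have sumkl : lip cdist
      (fun z => \sum_(t <- S2) dyadic_kernel i (cval z / cval t)).
    exact: lip_sum.
  have n1 := near_spectral_limit N_gt0 f_per f_01 resl Lres.
  have n2 := near_spectral_limit N_gt0 f_per f_01 sumkl Lker.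
  exact: (@filter_ex _ nat_ultra _ _ (filterI n1 (filterI n2 nK))).
set N := N_ k in k1 k2 k3; set f := f_ k in k1 k2.
have fN : forall x : int, f (x + N%:Z) = f x := f_per k.
have f01 : forall x, 0 <= f x <= 1 := f_01 k.
have N0 : (0 < N)%N := N_gt0 k.
pose F t := local_mean i t f.
pose Ur x := \sum_(n <- s_ j) (u_ j n)%:C *
  ((f (x - n))%:C - \sum_(t <- S ++ S2) F t (x - n)).
have symF t : has_symbol N f (F t) (fun z => dyadic_mean i (cval z / cval t)).
  exact: has_symbol_local_mean.
have symUr : has_symbol N f Ur (fun z =>
    (1 - \sum_(t <- S ++ S2) dyadic_mean i (cval z / cval t)) * u j z).
  have h0 := has_symbolB (has_symbol1 N0 fN) (has_symbol_sum (S ++ S2) symF).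
  have h (n : int) := has_symbolZ (u_ j n)%:C (has_symbol_shift n h0).
  have := has_symbol_sum (s_ j) h; congr has_symbol; apply/funext => z.
  by rewrite mulr_sumr; apply: eq_bigr => n _; rewrite mulrCA.
have FN t x : F t (x + N%:Z) = F t x.
  rewrite /F /local_mean; congr (_ * _); apply: eq_bigr => h _.
  by rewrite addrAC fN.
have UrN x : Ur (x + N%:Z) = Ur x.
  apply: eq_bigr => n _; rewrite addrAC fN; congr (_ * (_ - _)).
  by apply: eq_bigr => t _; rewrite FN.
pose F1 x := (2 ^+ i)^-1 * \sum_(h < 2 ^ i) f (x - h%:Z).
have F1E x : F circle1 x = (F1 x)%:C := local_mean1 f i x.
have F1le x : F1 x <= 1.
  have := local_mean_le1 i circle1 x f01; rewrite -/(F _) F1E cmod_real.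
  exact: le_trans (ler_norm _).
have F1sum : delta * N%:R <= \sum_(x < N) F1 x.
  apply: (le_trans (f_dense k)); rewrite -/f -/N -mulr_sumr exchange_big /=.
  have -> : \sum_(h < 2 ^ i) \sum_(x < N) f (x%:Z - h%:Z) =
      2 ^+ i * \sum_(x < N) f x.
    rewrite (eq_bigr (fun=> \sum_(x < N) f x)) => [|h _].
      by rewrite sumr_const card_ord -natrX mulr_natl.
    rewrite -(@sum_periodic_shift _ (fun x => f (x - h%:Z)) N h).
      by apply: eq_bigr => x _; rewrite addrK.
    by move=> x; rewrite addrAC fN.
  by rewrite mulKf// expf_neq0// pnatr_eq0.
have tsum : \sum_(x < N) \sum_(t <- S2) sqmod (F t x) <=
    N%:R * (theta ^+ 2 * delta / 8).
  rewrite exchange_big /=; under eq_bigr do rewrite (parseval N0 (symF _)).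
  rewrite -mulr_sumr ler_wpM2l//.
  have -> : theta ^+ 2 * delta / 8 = 3 * e0 by rewrite /e0; field.
  apply: (le_trans _ (ltW k2)); rewrite /spectral_functional exchange_big /=.
  by apply: ler_sum => m _; rewrite mulr_sumr.
have esum : \sum_(x < N) sqmod (Ur x) <=
    N%:R * (theta ^+ 2 * delta / (8 * W.+1%:R)).
  rewrite (parseval N0 symUr) ler_wpM2l// (le_trans _ (ltW k1))//.
  by apply: ler_sum => m _; rewrite [X in _ * X <= _]sqmodM.
have t_ge0 x : 0 <= \sum_(t <- S2) sqmod (F t x).
  by apply: sumr_ge0 => t _; exact: sqmod_ge0.
have [x [Bx xN F1x tx ex]] := exists_good_point delta_gt0
  (exprn_gt0 2 th0) (exprn_gt0 2 th0) F1le (fun x => sqmod_ge0 (Ur x)) t_ge0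
  (fun x => congr1 (@sqmod R) (UrN x)) F1sum tsum esum k3.
(* At the frequency 1 the two factors are the mass of [u_ j], at least [alpha], and the ordinary
   average [F1 x], at least delta / 4. *)
exists j, k, x, (fun t => u j t * F t x); split => //.
  split=> [t|].
    by rewrite cmodM ler_piMr ?cmod_ge0// local_mean_le1.
  rewrite F1E [X in complex.Re X]mulrC ReZ /wtransform Re_sum.
  under eq_bigr do rewrite ReZ exp1rz mulr1.
  rewrite -mulrA mulrC; apply: ler_pM; rewrite ?divr_ge0 ?(ltW alpha_gt0) 
    ?(ltW delta_gt0)//.
move=> l lW.
have := convolution_lower_bound f01 (u_ge0 j) (u_le1 j) (@s_bound j) (ltnW lW)
  th0 (ltW th0) j2 tx (ex l lW).
apply: le_trans; rewrite lerD2l lerN2.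
by move: j4; rewrite -/i /theta; have := th0; rewrite /theta; lra.
Qed.

End MainEstimate.

(** * Measures on the integers and densities *)

Section IntegerMeasures.
Context {R : realType}.
Variable mu : probability int R.
Implicit Types (f : int -> R) (s : seq int) (A : set int).

Definition int_mass (n : int) : R := fine (mu [set n]).

Lemma int_measurable A : measurable A.
Proof. by []. Qed.

Lemma int_mass_ge0 n : 0 <= int_mass n.
Proof. exact/fine_ge0/measure_ge0. Qed.

Lemma int_mu_lty A : (mu A < +oo)%E.
Proof. exact: le_lt_trans (probability_le1 mu (int_measurable A)) (ltry 1). Qed.

Lemma int_integrable A f C : (forall n, `|f n| <= C) ->
  mu.-integrable A (EFin \o f).
Proof.
move=> fC; apply: measurable_bounded_integrable.
- exact: int_measurable.
- exact: int_mu_lty.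
- by move=> _ Y _; exact: int_measurable.
- exists C; split; first exact: num_real.
  by move=> D CD n _ /=; exact: le_trans (fC n) (ltW CD).
Qed.

Lemma Rintegral_seq s f C : (forall n, `|f n| <= C) -> uniq s ->
  \int[mu]_(n in [set` s]) f n = \sum_(n <- s) int_mass n * f n.
Proof.
move=> fC; elim: s => [|m s ih] /=.
  by move=> _; rewrite big_nil set_nil Rintegral_set0.
move=> /andP[ms us]; rewrite big_cons -ih//.
have -> : [set` m :: s] = [set m] `|` [set` s].
  apply/seteqP; split=> n /=; rewrite inE.
    by move=> /predU1P[->|]; [left|right].
  by move=> [->|->]; rewrite ?eqxx ?orbT.
rewrite Rintegral_setU; try exact: int_measurable.
- congr (_ + _).
  rewrite (@eq_Rintegral _ _ _ _ _ (fun=> f m)); last first.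
    by move=> n; rewrite inE => ->.
  by rewrite Rintegral_cst; [exact: mulrC|exact: int_measurable].
- exact: int_integrable fC.
- apply/disj_setPS => n [/= -> ns].
  by move: ms; rewrite ns.
Qed.

Lemma Rintegral_approx s f : uniq s -> (forall n, `|f n| <= 1) ->
  `|\int[mu]_(n in setT) f n - \sum_(n <- s) int_mass n * f n| <=
  1 - \sum_(n <- s) int_mass n.
Proof.
move=> us f1.
have split_int g : (forall n, `|g n| <= 1) -> \int[mu]_(n in setT) g n =
    \sum_(n <- s) int_mass n * g n + \int[mu]_(n in ~` [set` s]) g n.
  move=> g1; rewrite -(setUv [set` s]) Rintegral_setU.
  - by rewrite (Rintegral_seq g1 us).
  - exact: int_measurable.
  - exact: int_measurable.
  - exact: int_integrable g1.
  - by apply/disj_setPS; rewrite setICr.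
have one (n : int) : `|(1 : R)| <= 1 by rewrite normr1.
have tot : 1 - \sum_(n <- s) int_mass n = \int[mu]_(n in ~` [set` s]) 1.
  have tot1 : \int[mu]_(n in setT) (1 : R) = 1.
    rewrite Rintegral_cst; last exact: int_measurable.
    by rewrite mul1r; exact: (congr1 fine (probability_setT mu)).
  rewrite -[X in X - _]tot1 (split_int _ one).
  rewrite addrAC (eq_bigr int_mass) => [|n _]; last by rewrite mulr1.
  by rewrite subrr add0r.
rewrite split_int// addrAC subrr add0r tot.
apply: (le_trans (le_normr_Rintegral _ (int_integrable _ f1))).
  exact: int_measurable.
apply: le_Rintegral => //.
- by apply: (@int_integrable _ _ 1) => n; rewrite normr_id.
- exact: int_integrable one.
Qed.

Definition int_ball (B : nat) : seq int :=
  [seq m%:Z - B%:Z | m <- iota 0 (2 * B).+1].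

Lemma uniq_int_ball B : uniq (int_ball B).
Proof.
by rewrite map_inj_uniq ?iota_uniq// => m n /(addIr _) [].
Qed.

Lemma mem_int_ball B n : (n \in int_ball B) = (absz n <= B)%N.
Proof.
apply/mapP/idP => [[m]|nB]; first by rewrite mem_iota => mB ->; lia.
exists (absz (n + B%:Z)); first by rewrite mem_iota; lia.
by lia.
Qed.

Lemma exists_int_ball e : 0 < e ->
  exists B, 1 - \sum_(n <- int_ball B) int_mass n <= e.
Proof.
move=> e0; pose F B : set int := [set` int_ball B].
have FE B n : F B n = (n \in int_ball B) by [].
have FT : \bigcup_B F B = setT.
  by apply/seteqP; split => // n _; exists (absz n) => //; rewrite FE mem_int_ball.
have : (mu \o F) x @[x --> \oo] --> mu (\bigcup_n F n).
  apply: nondecreasing_cvg_mu.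
  - by move=> i; exact: int_measurable.
  - exact: int_measurable.
  - move=> m n mn; apply/subsetPset => k.
    by rewrite !FE !mem_int_ball => /leq_trans; exact.
rewrite FT probability_setT => /fine_cvg /=.
move=> /cvgrPdist_le /(_ e e0)[B _ /(_ B (leqnn B))] /= h; exists B.
apply: le_trans h; apply: le_trans (ler_norm _).
rewrite lerB//.
have := Rintegral_seq (f := fun=> 1) (C := 1) _ (uniq_int_ball B).
rewrite Rintegral_cst; last exact: int_measurable.
rewrite mul1r => -> => [|n]; last by rewrite normr1.
by apply: ler_sum => n _; rewrite mulr1.
Qed.

End IntegerMeasures.

Section TruncatedWeights.
Context {R : realType}.
Variables (nu : nat -> probability int R) (A : set int).
Hypothesis nu_equi : equidistributed nu.

(** Pick phi m >= m such that A has mass above [a_ m], and restrict that measure to a ball missing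
    mass at most e / (m + 1). The weights are not renormalised. The reindexing need not be
    increasing: phi m >= m suffices for limits. *)
Lemma truncated_weights (a_ : nat -> R) (e : R) : 0 < e ->
  (forall m, exists2 j, (m <= j)%N & a_ m < fine (nu j A)) ->
  exists (B_ : nat -> nat) (w_ : nat -> int -> R),
    [/\ forall m n, 0 <= w_ m n,
        forall m, \sum_(n <- int_ball (B_ m)) w_ m n <= 1,
        forall z : circle R, cval z != 1 ->
          cmod (wtransform (int_ball (B_ m)) (w_ m) z) @[m --> \oo] --> (0 : R) &
        forall m, a_ m - e / m.+1%:R <=
          \sum_(n <- int_ball (B_ m)) w_ m n * \1_A n].
Proof.
move=> e0 aA.
have /choice[phi phiP] m : exists j, (m <= j)%N /\ a_ m < fine (nu j A).
  by have [j] := aA m; exists j.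
pose e_ m := e / m.+1%:R.
have e_0 m : 0 < e_ m by rewrite divr_gt0.
have /choice[B_ BP] m := exists_int_ball (nu (phi m)) (e_0 m).
exists B_, (fun m => int_mass (nu (phi m))).
have approx m (f : int -> R) : (forall n, `|f n| <= 1) ->
    `|\int[nu (phi m)]_(n in setT) f n -
      \sum_(n <- int_ball (B_ m)) int_mass (nu (phi m)) n * f n| <= e_ m.
  move=> f1; apply: le_trans (BP m).
  exact: Rintegral_approx (uniq_int_ball _) f1.
split.
- by move=> m n; exact: int_mass_ge0.
- move=> m; rewrite -subr_ge0.
  (* For the zero function the approximation bound says that the missing mass is nonnegative. *)
  refine (le_trans (normr_ge0 _) (Rintegral_approx (nu (phi m)) (f := fun=> 0)
    (uniq_int_ball (B_ m)) _)).
  by move=> n; rewrite normr0.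
- move=> z /circle_angle[t t02pi zt].
  have := nu_equi t02pi; set I := fun j => cintegral _ _ => I0.
  have cI0 : cmod (I (phi m)) @[m --> \oo] --> (0 : R).
    apply/cvgrPdist_lt => d d0.
    have dC : 0 < d%:C :> R[i] by rewrite ltcR.
    move/cvgrPdist_lt : I0 => /(_ _ dC)[N _ NP].
    exists N => // m /= Nm; have := NP (phi m) (leq_trans Nm (phiP m).1).
    rewrite sub0r normrN norm_cmod ltcR sub0r normrN ger0_norm//.
    exact: cmod_ge0.
  apply: (@squeeze_cvgr _ _ _ _ (cst 0) (fun m => cmod (I (phi m)) + 2 * e_ m)).
  + near=> m; rewrite cmod_ge0 /=.
    set W := wtransform _ _ _.
    have : cmod (I (phi m) - W) <= 2 * e_ m.
      rewrite (le_trans (cmod_le_sum _))// mulr_natl mulr2n.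
      rewrite ReD ReN ImD ImN /W /wtransform Re_sum Im_sum /I /cintegral /=.
      under [X in `|_ - X| + _]eq_bigr do rewrite ReZ zt -expi_intl /=.
      under [X in _ + `|_ - X|]eq_bigr do rewrite ImZ zt -expi_intl /=.
      apply: lerD; apply: approx => n.
        by rewrite ler_norml cos_geN1 cos_le1.
      by rewrite ler_norml sin_geN1 sin_le1.
    have := cmodD (W - I (phi m)) (I (phi m)); rewrite subrK cmodB; lra.
  + exact: cvg_cst.
  + rewrite -[X in _ --> X](addr0 0); apply: cvgD => //.
    rewrite -[X in _ --> X](mulr0 2); apply: cvgMr.
    rewrite -[X in _ --> X](mulr0 e); apply: cvgMr; exact: cvg_harmonic.
- move=> m.
  have ind (n : int) : `|\1_A n : R| <= 1.
    by rewrite indicE ger0_norm// lern1 leq_b1.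
  have := approx m _ ind.
  have -> : \int[nu (phi m)]_(n in setT) (\1_A n : R) = fine (nu (phi m) A).
    by rewrite /Rintegral integral_indic ?setIT.
  have [_ /ltW h] := phiP m; rewrite /e_.
  move=> /(le_trans (ler_norm _)); rewrite lerBlDr => h2.
  by rewrite lerBlDr addrC (le_trans h)// addrC.
Unshelve. all: by end_near. Qed.

End TruncatedWeights.

Lemma limn_esup_gt {R : realType} (u : nat -> \bar R) (a : \bar R) :
  (a < limn_esup u)%E -> forall m, exists2 j, (m <= j)%N & (a < u j)%E.
Proof.
move=> au m; pose V := [set j : nat | (m <= j)%N].
have : (limn_esup u <= ereal_sup (u @` V))%E.
  by apply: ereal_inf_lbound; exists V => //; exists m.
move=> /(lt_le_trans au) /ereal_sup_gt[_ [j mj <-] auj].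
by exists j.
Qed.

Section UpperBanachDensity.
Context {R : realType}.
Variable B : set int.

Lemma card_int_interval (x : int) (N : nat) :
  (#|` fset_set (B `&` int_interval x N)|)%:R <=
  \sum_(y < N) \1_B (x + y%:Z) :> R.
Proof.
pose s := [seq x + y%:Z | y <- iota 0 N & `[< B (x + y%:Z) >]].
have sub z : (B `&` int_interval x N) z -> z \in s.
  rewrite /int_interval /= in_itv /= => -[Bz /andP[xz zN]].
  apply/mapP; exists (absz (z - x)); last by lia.
  rewrite mem_filter mem_iota; apply/andP; split; last by lia.
  by apply/asboolP; have -> : x + (absz (z - x))%:Z = z by lia.
have fin : finite_set (B `&` int_interval x N).
  by apply: sub_finite_set (finite_seq s) => z /sub.
apply: (@le_trans _ _ (size s)%:R).
  rewrite ler_nat; apply: uniq_leq_size; first exact: fset_uniq.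
  by move=> z; rewrite in_fset_set// => /set_mem/sub.
rewrite size_map size_filter -sum1_count natr_sum big_mkcond /=.
rewrite -[N in iota 0 N]subn0 big_mkord; apply: ler_sum => y _.
rewrite indicE; have -> : (x + y%:Z \in B) = `[< B (x + y%:Z) >] by [].
by case: asbool.
Qed.

Lemma dense_intervals : 0 < upper_banach_density R B ->
  exists2 delta : R, 0 < delta & forall k, exists x : int, exists2 N : nat,
    (k < N)%N & delta * N%:R <= \sum_(y < N) \1_B (x + y%:Z).
Proof.
rewrite /upper_banach_density; set g := (fun M : nat => sup _) => g0.
(* A divergent [limn] takes the default value 0, so positivity of the density already gives
   convergence. *)
have gcv : cvgn g.
  by apply: contrapT => /dvgP gp; move: g0; rewrite gp ltxx.
exists (limn g / 2); first by rewrite divr_gt0.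
move=> k; have h : limn g / 2 < limn g.
  by rewrite ltr_pdivrMr// mulr_natr mulr2n ltrDl.
have [n0 _ n0P] := cvgr_gt _ gcv _ h.
pose N := maxn n0 k.+1.
have N0 : 0 < N%:R :> R by rewrite ltr0n /N; lia.
have := n0P N (leq_maxl _ _); rewrite /g => /sup_gt[].
  by exists ((#|` fset_set (B `&` int_interval 0 N)|)%:R / N%:R), 0.
move=> _ [x _ <-] lt; exists x, N; first by rewrite /N; lia.
rewrite -ler_pdivlMr//; apply: (le_trans (ltW lt)).
by rewrite ler_wpM2r ?invr_ge0 ?(ltW N0)// card_int_interval.
Qed.

End UpperBanachDensity.

(** * Passage to the limit *)

Section LimitTrigonometricPolynomial.
Context {R : realType}.
Local Notation T := (circle R).
Variables (E : set int) (S : seq T) (c : R) (X : nat -> int)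
  (p : nat -> T -> R[i]).
Hypothesis uS : uniq S.
Hypothesis S1 : circle1 \in S.
Hypothesis c_gt0 : 0 < c.
Hypothesis p_le1 : forall W t, cmod (p W t) <= 1.
Hypothesis p_ge : forall W, c <= complex.Re (p W circle1).
Hypothesis window : forall W l, (l < W)%N ->
  c / 4 < complex.Re (\sum_(t <- S) p W t * cval t ^ (- (X W + l%:Z))) ->
  E (X W + l%:Z).

Let q t : R[i] := Complex (ulim (fun W => complex.Re (p W t)))
  (ulim (fun W => complex.Im (p W t))).

Let cvg_Re t : complex.Re (p W t) @[W --> nat_ultra] --> complex.Re (q t).
Proof.
by apply: (@ulim_cvg _ _ 1) => W; exact: le_trans (Re_le_cmod _) (p_le1 W t).
Qed.

Let cvg_Im t : complex.Im (p W t) @[W --> nat_ultra] --> complex.Im (q t).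
Proof.
apply: (@ulim_cvg _ _ 1) => W; apply: le_trans (p_le1 W t).
rewrite -ler_sqr ?nnegrE ?cmod_ge0// sqr_cmod real_normK ?num_real//.
by rewrite /sqmod lerDr sqr_ge0.
Qed.

Let near_q : \forall W \near nat_ultra, \sum_(t <- S) cmod (p W t - q t) < c / 4.
Proof.
have h : (fun W => \sum_(t <- S) (`|complex.Re (q t) - complex.Re (p W t)| +
    `|complex.Im (q t) - complex.Im (p W t)|)) @ nat_ultra --> (0 : R).
  rewrite [X in _ --> X](_ : 0 = \sum_(t <- S) (0 + 0) :> R); last first.
    by rewrite big1// => t _; rewrite addr0.
  apply: cvg_big => [|t _]; first exact: add_continuous.
  have dist0 (u : nat -> R) l : u @ nat_ultra --> l ->
      `|l - u W| @[W --> nat_ultra] --> (0 : R).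
    move=> ul; rewrite -(@normr0 _ R) -(subrr l); apply: cvg_norm.
    by apply: cvgB => //; exact: cvg_cst.
  by apply: cvgD; apply: dist0; [exact: cvg_Re|exact: cvg_Im].
have c4 : 0 < c / 4 by rewrite divr_gt0.
apply: filterS (cvgr_lt _ h _ c4) => W; apply: le_lt_trans.
apply: ler_sum => t _; rewrite cmodB (le_trans (cmod_le_sum _))//.
by rewrite ReD ReN ImD ImN.
Qed.

Let q1_ge : c <= complex.Re (q circle1).
Proof.
apply: (@cvgr_to_ge _ nat_ultra _ _ _ _ _ (@cvg_Re circle1)).
by apply: nearW => W; exact: p_ge.
Qed.

(** The constant c / 2 separates two margins: the mean of the sum is at least [c], so [P] is
    positive somewhere; and where [P] is positive, the polynomial of a window with coefficients
    within c / 4 of [q] exceeds the threshold c / 4. *)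
Let P (n : int) : R := complex.Re (\sum_(t <- S) q t * cval t ^ (- n)) - c / 2.

Let thick_window : thick [set n | 0 < P n -> E n].
Proof.
move=> L; have [W [LW near_W]] :=
  @filter_ex _ nat_ultra _ _ (filterI (nat_ultra_ge L) near_q).
exists (X W) => n; rewrite /int_interval /= in_itv /= => /andP[Xn nX].
have nE : n = X W + (absz (n - X W))%:Z by lia.
rewrite subr_gt0 nE => Pn; apply: window; first by lia.
move: (X W + _) Pn => m Pm.
have : cmod (\sum_(t <- S) q t * cval t ^ (- m) -
    \sum_(t <- S) p W t * cval t ^ (- m)) <= \sum_(t <- S) cmod (p W t - q t).
  rewrite -sumrB (le_trans (cmod_sum _ _ _))//; apply: ler_sum => t _.
  by rewrite -mulrBl cmodM circle_exprz mulr1 cmodB.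
move=> /(le_trans (Re_le _)); rewrite ReD ReN.
by move: near_W Pm; lra.
Qed.

(** The mean of the sum over 0 <= n < 2^i tends to the coefficient at 1, of real part at least [c];
    it could not do so if [P] were nowhere positive. *)
Let P_positive : exists n, 0 < P n.
Proof.
apply: contrapT => /forallNP nP.
pose a i := \sum_(t <- S | t != circle1) cmod (q t * dyadic_mean i (cval t)^-1).
have a0 : a i @[i --> \oo] --> (0 : R).
  rewrite [X in _ --> X](_ : 0 = \sum_(t <- S | t != circle1) 0 :> R); last first.
    by rewrite big1.
  apply: cvg_big => [|t t1]; first exact: add_continuous.
  have -> : (fun i => cmod (q t * dyadic_mean i (cval t)^-1)) =
      (fun i => cmod (q t) * cmod (dyadic_mean i (cval t)^-1)).
    by apply/funext => i; rewrite cmodM.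
  rewrite -[X in _ --> X](mulr0 (cmod (q t))); apply: cvgMr.
  have := circle_ratio_neq1 t1; rewrite eq_sym /= divr1 => tn1.
  apply: cvg_dyadic_mean; first by rewrite cmodV circle_cmod invr1.
  by rewrite invr_eq1 eq_sym.
have : \forall i \near \oo, a i < c / 2.
  by apply: (cvgr_lt _ a0); rewrite divr_gt0.
case=> i _ /(_ i (leqnn i)) /=; apply/negP; rewrite -leNgt.
have mean_le : complex.Re (\sum_(t <- S) q t * dyadic_mean i (cval t)^-1) <= c / 2.
  have -> : \sum_(t <- S) q t * dyadic_mean i (cval t)^-1 =
      ((2 ^+ i)^-1)%:C * \sum_(h < 2 ^ i) \sum_(t <- S) q t * cval t ^ (- h%:Z).
    rewrite exchange_big mulr_sumr /=; apply: eq_bigr => t _.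
    rewrite -mulr_sumr mulrCA /dyadic_mean fmorphV rmorphXn rmorph_nat.
    congr (_ * (_ * _)).
    by apply: eq_bigr => h _; rewrite -exprnN exprVn.
  rewrite ReZ Re_sum mulrC ler_pdivrMr ?exprn_gt0//.
  rewrite -natrX -[leRHS](_ : \sum_(h < 2 ^ i) c / 2 = _); last first.
    by rewrite sumr_const card_ord mulr_natr.
  apply: ler_sum => h _; have /negP := nP h%:Z.
  by rewrite -leNgt subr_le0.
move: mean_le; rewrite (bigD1_seq circle1)//= invr1 dyadic_mean1 mulr1 ReD.
have : - a i <= complex.Re
    (\sum_(t <- S | t != circle1) q t * dyadic_mean i (cval t)^-1).
  by apply: (le_trans _ (Re_leN _)); rewrite lerN2 cmod_sum.
by have := q1_ge; lra.
Qed.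

Lemma limit_piecewise_bohr : piecewise_bohr R E.
Proof.
exists [set n | 0 < P n], [set n | 0 < P n -> E n]; split.
- have /choice[ang angP] (t : T) : exists x : R, cval t = expi x.
    have [t1|] := eqVneq (cval t) 1; first by exists 0; rewrite expi0.
    by move=> /circle_angle[x _ tx]; exists x.
  (* The constant -c / 2 enters as a term of frequency 0; the other angles change sign because the
     sum has the exponent -n. *)
  pose Ls : seq (R[i] * R) := ((- (c / 2))%:C, 0) :: [seq (q t, - ang t) | t <- S].
  exists (size Ls), (fun j => (nth (0, 0) Ls j).1), (fun j => (nth (0, 0) Ls j).2).
  have tE n : complex.Re (trig_poly (fun j : 'I_(size Ls) => (nth (0, 0) Ls j).1)
      (fun j => (nth (0, 0) Ls j).2) n) = P n.
    rewrite /trig_poly.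
    rewrite -(big_mkord xpredT (fun j => (nth (0, 0) Ls j).1 *
      expi ((nth (0, 0) Ls j).2 * n%:~R))).
    rewrite -(big_nth (0, 0) xpredT (fun l : R[i] * R => l.1 * expi (l.2 * n%:~R))).
    rewrite big_cons /= mul0r expi0 mulr1 ReD /= addrC big_map; congr (_ + _).
    congr (complex.Re _); apply: eq_bigr => t _ /=.
    by rewrite mulNr expiN mulrC mulrC [X in expi X]mulrC expi_intl -angP invr_expz.
  split=> [|n]; last by rewrite /= tE.
  by have [n Pn] := P_positive; exists n; rewrite /= tE.
- exact: thick_window.
- by move=> n [/= Pn]; exact.
Qed.

Lemma limit_thick : (forall t, cval t != 1 ->
    cmod (p W t) @[W --> \oo] --> (0 : R)) -> thick E.
Proof.
move=> p0; have q0 t : cval t != 1 -> q t = 0.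
  move=> t1; have ev (u : nat -> R) : u @ \oo --> (0 : R) ->
      u @ nat_ultra --> (0 : R).
    by move=> u0 U /u0; exact: eventually_nat_ultra.
  have small (u : nat -> R) : (forall W, `|u W| <= cmod (p W t)) ->
      u @ nat_ultra --> (0 : R).
    move=> up; apply: ev; apply/cvgrPdist_le => e e0.
    have /cvgrPdist_le/(_ e e0) := p0 t t1; apply: filterS => W.
    rewrite !sub0r !normrN ger0_norm ?cmod_ge0//.
    exact: le_trans.
  rewrite /q (cvg_ulim (small _ _)); last by move=> W; exact: Re_le_cmod.
  rewrite (cvg_ulim (small _ _))// => W.
  rewrite -ler_sqr ?nnegrE ?cmod_ge0// sqr_cmod real_normK ?num_real//.
  by rewrite /sqmod lerDr sqr_ge0.
have P_gt0 n : 0 < P n.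
  rewrite /P (bigD1_seq circle1)//= big_seq_cond big1 => [|t]; last first.
    by move=> /andP[_ t1]; rewrite q0 ?mul0r.
  by rewrite addr0 exp1rz mulr1; have := q1_ge; have := c_gt0; lra.
move=> L; have [N NP] := thick_window L; exists N => n /NP /=; apply.
exact: P_gt0.
Qed.

End LimitTrigonometricPolynomial.

(** * Application to the sumset *)

Section SumsetStructure.
Context {R : realType}.
Local Notation T := (circle R).
Variables (nu : nat -> probability int R) (A B : set int).
Hypothesis nu_equi : equidistributed nu.
Hypothesis B_dense : 0 < upper_banach_density R B.

(** Serves both implications: the first with a constant sequence, the second with one tending to 1.
    The bound [alpha] keeps the mass of the weights on A away from 0. *)
Lemma sumset_structure (a_ : nat -> R) (alpha : R) : 0 < alpha ->
  (forall m, alpha <= a_ m) ->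
  (forall m, exists2 j, (m <= j)%N & a_ m < fine (nu j A)) ->
  piecewise_bohr R (sumset A B) /\
  (a_ @ \oo --> (1 : R) -> thick (sumset A B)).
Proof.
move=> al0 a_ge aA.
(* Truncation costs at most alpha / 2 / (m + 1): a mass of alpha / 2 always remains, and the cost
   tends to 0, as thickness requires. *)
have al2 : 0 < alpha / 2 by rewrite divr_gt0.
have [B_ [w_ [w_ge0 w_le1 w_equi w_A]]] := truncated_weights nu_equi al2 aA.
pose u_ m n := w_ m n * \1_A n.
have u_le m n : 0 <= u_ m n <= w_ m n.
  rewrite /u_ indicE; case: (n \in A) => /=.
    by rewrite mulr1 w_ge0 lexx.
  by rewrite mulr0 lexx w_ge0.
have err m : 0 < alpha / 2 / m.+1%:R by rewrite divr_gt0.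
have u_ge m : alpha / 2 <= \sum_(n <- int_ball (B_ m)) u_ m n.
  apply: le_trans (w_A m); have := a_ge m.
  have : alpha / 2 / m.+1%:R <= alpha / 2.
    by rewrite ler_pdivrMr// ler_pMr// ler1n.
  by move: (alpha / 2 / m.+1%:R) => y; lra.
have [delta d0 /choice[x0 dP]] := dense_intervals B_dense.
have /choice[N_ NP] k : exists N, (k < N)%N /\
    delta * N%:R <= \sum_(y < N) \1_B (x0 k + y%:Z).
  by have [N kN h] := dP k; exists N.
pose f_ k (y : int) : R := \1_B (x0 k + (y %% (N_ k)%:Z)%Z).
have f_per k (y : int) : f_ k (y + (N_ k)%:Z) = f_ k y.
  by rewrite /f_ modzDr.
have f_01 k y : 0 <= f_ k y <= 1.
  by rewrite /f_ indicE ler0n lern1 leq_b1.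
have f_dense k : delta * (N_ k)%:R <= \sum_(y < N_ k) f_ k y.
  rewrite (le_trans (NP k).2)//; apply: ler_sum => y _.
  by rewrite /f_ modz_small//= ltz_nat.
have s_bound j : {in int_ball (B_ j), forall n, (absz n <= B_ j)%N}.
  by move=> n; rewrite mem_int_ball.
have N_gt k : (k < N_ k)%N := (NP k).1.
have [S [uS S1] SP] := structured_convolution s_bound w_ge0 w_le1 w_equi u_le
  al2 u_ge N_gt f_per f_01 d0 f_dense.
have win W : exists r : nat * int * (T -> R[i]), [/\ (W <= r.1.1)%N,
    forall t, cmod (r.2 t) <= cmod (wtransform (int_ball (B_ r.1.1)) (u_ r.1.1) t),
    alpha / 2 * delta / 4 <= complex.Re (r.2 circle1) &
    forall l, (l < W)%N -> alpha / 2 * delta / 4 / 4 <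
      complex.Re (\sum_(t <- S) r.2 t * cval t ^ (- (r.1.2 + l%:Z))) ->
      sumset A B (r.1.2 + l%:Z)].
  have [j [k [x [p [Wj Bx xN [pu p1] pl]]]]] := SP W W.
  pose Y := x0 k + x%:Z.
  (* The twist by t^Y changes the exponent -l into -(Y + l): the polynomials of all windows then
     refer to absolute positions and their coefficients can be compared. Moduli and the coefficient
     at 1 are unchanged. *)
  exists (j, Y, fun t => p t * cval t ^ Y); split => //=.
  - by move=> t; rewrite cmodM circle_exprz mulr1.
  - by rewrite exp1rz mulr1.
  move=> l lW.
  have -> : \sum_(t <- S) p t * cval t ^ Y * cval t ^ (- (Y + l%:Z)) =
      \sum_(t <- S) p t * cval t ^- l.
    apply: eq_bigr => t _; rewrite -mulrA -expfzDr ?circle_neq0//.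
    by rewrite opprD addrA subrr add0r -exprnN.
  move=> big; have : 0 < \sum_(n <- int_ball (B_ j)) u_ j n * f_ k (x%:Z + l%:Z - n).
    apply: lt_le_trans (pl l lW); rewrite subr_gt0; apply: le_lt_trans big.
    by lra.
  have [/hasP[n ns]|/hasPn all0] := boolP (has (fun n =>
      u_ j n * f_ k (x%:Z + l%:Z - n) != 0) (int_ball (B_ j))); last first.
    rewrite big_seq big1 ?ltxx// => n /all0.
    by rewrite negbK => /eqP.
  rewrite mulf_eq0 negb_or => /andP[un fn] _.
  have An : A n.
    by move: un; rewrite /u_ indicE; have [/set_mem|] := boolP (n \in A);
      rewrite //= mulr0 eqxx.
  have nB : (absz n <= B_ j)%N by rewrite -mem_int_ball.
  (* No wrap-around: |n| <= B_j <= x and x + W + B_j <= N_k place x + l - n in [0, N_k). *)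
  have Bn : B (x0 k + (x%:Z + l%:Z - n)).
    move: fn; rewrite /f_ modz_small; last by lia.
    by rewrite indicE; have [/set_mem|] := boolP (_ \in B); rewrite //= eqxx.
  exists n => //; exists (x0 k + (x%:Z + l%:Z - n)) => //.
  by rewrite /Y; ring.
have /choice[r rP] := win.
split.
  apply: (@limit_piecewise_bohr _ (sumset A B) S (alpha / 2 * delta / 4)
    (fun W => (r W).1.2) (fun W => (r W).2)) => //.
  - by rewrite divr_gt0 ?mulr_gt0.
  - move=> W t; have [_ pu _ _] := rP W; apply: (le_trans (pu t)).
    exact: (u_transform_le1 w_le1 u_le).
  - by move=> W; case: (rP W).
  - by move=> W; case: (rP W).
move=> a1.
apply: (@limit_thick _ (sumset A B) S (alpha / 2 * delta / 4)
    (fun W => (r W).1.2) (fun W => (r W).2)) => //.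
- by rewrite divr_gt0 ?mulr_gt0.
- move=> W t; have [_ pu _ _] := rP W; apply: (le_trans (pu t)).
  exact: (u_transform_le1 w_le1 u_le).
- by move=> W; case: (rP W).
- by move=> W; case: (rP W).
move=> t t1.
(* Restricting the weights to A changes the transform by at most the weight removed, which is at
   most 1 - a_j plus the truncation cost. *)
pose d j := cmod (wtransform (int_ball (B_ j)) (w_ j) t) +
  (1 - a_ j + alpha / 2 / j.+1%:R).
have d0' : d j @[j --> \oo] --> (0 : R).
  rewrite -[X in _ --> X](addr0 0); apply: cvgD; first exact: w_equi.
  rewrite -[X in _ --> X](addr0 0); apply: cvgD.
    by rewrite -(subrr (1 : R)); apply: cvgB => //; exact: cvg_cst.
  rewrite -[X in _ --> X](mulr0 (alpha / 2)); apply: cvgMr.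
  exact: cvg_harmonic.
have ud j : cmod (wtransform (int_ball (B_ j)) (u_ j) t) <= d j.
  rewrite /d; set ut := wtransform _ (u_ j) t; set wt := wtransform _ (w_ j) t.
  have : cmod (wt - ut) <= 1 - a_ j + alpha / 2 / j.+1%:R.
    rewrite /wt /ut /wtransform -sumrB (le_trans (cmod_sum _ _ _))//.
    apply: (@le_trans _ _ (\sum_(n <- int_ball (B_ j)) (w_ j n - u_ j n))).
      apply: ler_sum => n _; rewrite -mulrBl -rmorphB /= cmodM circle_exprz mulr1.
      by rewrite cmod_real ger0_norm// subr_ge0; case/andP: (u_le j n).
    rewrite sumrB /u_; have := w_le1 j; have := w_A j.
    by move: (alpha / 2 / j.+1%:R) => y; lra.
  have := cmodD (ut - wt) wt; rewrite subrK (cmodB ut).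
  by move: (alpha / 2 / j.+1%:R) => y; lra.
apply: (@squeeze_cvgr _ _ _ _ (cst 0) (fun W => d (r W).1.1)).
- near=> W; rewrite cmod_ge0 /=; have [_ pu _ _] := rP W.
  exact: le_trans (pu t) (ud _).
- exact: cvg_cst.
- have rW : (r W).1.1 @[W --> \oo] --> \oo.
    apply/cvgnyPge => M; exists M => // W /= MW; have [h _ _ _] := rP W.
    exact: leq_trans MW h.
  exact: cvg_comp rW d0'.
Unshelve. all: by end_near. Qed.

End SumsetStructure.

Theorem theorem1p4 (R : realType) (nu : nat -> probability int R)
    (A B : set int)
    (nu_equi : equidistributed nu) (B_dense : 0 < upper_banach_density R B) :
  ((0 < density_along nu A)%E -> piecewise_bohr R (sumset A B)) /\
  (density_along nu A = 1%E -> thick (sumset A B)).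
Proof.
have fine_gt (a : R) j : (a%:E < nu j A)%E -> a < fine (nu j A).
  move=> h; rewrite -lte_fin fineK//.
  by rewrite ge0_fin_numE ?measure_ge0// int_mu_lty.
split=> [dA|dA].
  have [a a0 al] : exists2 a : R, 0 < a & (a%:E < density_along nu A)%E.
    case: (density_along nu A) dA => [r| |] //.
    - rewrite lte_fin => r0; exists (r / 2); first by rewrite divr_gt0.
      by rewrite lte_fin ltr_pdivrMr// mulr_natr mulr2n ltrDl.
    - by exists 1; rewrite ?ltry.
  have aA m : exists2 j, (m <= j)%N & a < fine (nu j A).
    by have [j mj /fine_gt h] := limn_esup_gt al m; exists j.
  by have [] := sumset_structure nu_equi B_dense a0 (fun=> lexx a) aA.
(* The shift to m + 2 makes [a_ 0] equal to 1/2, so that 1/2 is a lower bound for the whole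
   sequence. *)
pose a_ m : R := 1 - m.+2%:R^-1.
have a_lt m : ((a_ m)%:E < density_along nu A)%E.
  by rewrite dA lte_fin gtrBl invr_gt0.
have aA m : exists2 j, (m <= j)%N & a_ m < fine (nu j A).
  by have [j mj /fine_gt h] := limn_esup_gt (a_lt m) m; exists j.
have half : 0 < 2^-1 :> R by rewrite invr_gt0.
have a_ge m : 2^-1 <= a_ m.
  have : (m.+2%:R : R)^-1 <= 2^-1 by rewrite lef_pV2 ?posrE// ler_nat.
  by rewrite /a_; move: (m.+2%:R^-1 : R) => y; lra.
have [_] := sumset_structure nu_equi B_dense half a_ge aA; apply.
rewrite -[X in _ --> X](subr0 1); apply: cvgB; first exact: cvg_cst.
have h := @cvg_harmonic R; rewrite -cvg_shiftS in h; exact: h.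
Qed.
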